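(* Let $\eta<\frac23$ and let $f\in\mathcal{P}(\mathbb{S}^2)$ be a global minimiser of $\mathcal{F}$. Then there exist $Q,\Lambda\in\mathrm{Sym}_0(3)$ and $Z>0$ such that $f$ satisfies the Euler-Lagrange equation $$f(p)=\frac1Z\exp(\Lambda p\cdot p)\max(Qp\cdot p-\eta,0),$$ $$Q=\int_{\mathbb{S}^2}f(p)\left(p\otimes p-\tfrac13I\right)dp,\qquad \Lambda=\int_{\mathbb{S}^2}\frac{f(p)}{Qp\cdot p-\eta}\left(p\otimes p-\tfrac13I\right)dp.$$ Furthermore, $(Q,\Lambda)$ solves the saddle point problem $$\min_{Q_0\in\mathrm{dom}(J)}\ \max_{\lambda\in\mathrm{Sym}_0(3)}\ Q_0\cdot\lambda-\ln\left(\int_{\mathbb{S}^2}\exp(\lambda p\cdot p)\max(Q_0p\cdot p-\eta,0)\,dp\right)$$ (that is, $Q$ attains the outer minimum and $\Lambda$ attains the inner maximum at $Q_0=Q$), and $J(Q)=\min_{Q_0\in\mathcal{Q}}J(Q_0)$.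
   Context: $\mathbb{S}^2\subset\mathbb{R}^3$ is the unit sphere and $dp$ is the 2-dimensional Hausdorff measure on it. $\mathrm{Sym}_0(3)$ is the space of traceless symmetric real $3\times3$ matrices with $A\cdot B=\mathrm{Tr}(AB)$; $\mathcal{Q}=\{Q\in\mathrm{Sym}_0(3):v_{\min}(Q)>-\frac13\}$, $v_{\min}$ denoting the smallest eigenvalue. $\mathcal{P}(\mathbb{S}^2)=\{f\in L^1(\mathbb{S}^2): f\ge 0 \text{ a.e.},\ \int_{\mathbb{S}^2}f\,dp=1\}$. For fixed $\eta\in\mathbb{R}$ the energy $\mathcal{F}:\mathcal{P}(\mathbb{S}^2)\to\mathbb{R}\cup\{+\infty\}$ is $$\mathcal{F}(f)=\int_{\mathbb{S}^2}f(p)\ln f(p)-f(p)\ln\left(\int_{\mathbb{S}^2}\left((p\cdot q)^2-\tfrac13\right)f(q)\,dq-\eta\right)dp,$$ where $-\ln$ is extended by $+\infty$ for non-positive arguments, $0\times(+\infty)=0$ and $0\ln 0=0$. For $Q\in\mathcal{Q}$, $A(Q)=\{f\in\mathcal{P}(\mathbb{S}^2):\int_{\mathbb{S}^2}(p\otimes p-\frac13I)f(p)\,dp=Q\}$, $J(Q)=\inf_{f\in A(Q)}\mathcal{F}(f)$ and $\mathrm{dom}(J)=\{Q\in\mathcal{Q}:J(Q)<+\infty\}$. Quotients $\frac{f(p)}{Qp\cdot p-\eta}$ are taken to be $0$ where $Qp\cdot p\le\eta$ (where $f=0$). Equalities between densities are a.e. *)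

(* Defs.v *)
From HB Require Import structures.
From mathcomp Require Import all_boot all_order all_algebra.
From mathcomp Require Import all_classical all_reals all_analysis.

Set Implicit Arguments.
Unset Strict Implicit.
Unset Printing Implicit Defensive.

Import Order.TTheory GRing.Theory Num.Theory.
Import numFieldNormedType.Exports.

Local Open Scope classical_set_scope.
Local Open Scope ring_scope.

(* The library's norm on matrices is the sup norm, so the Euclidean structure
   of R^3 is set up by hand. *)
Definition dot (R : realType) (p q : 'cV[R]_3) : R := (p^T *m q) 0 0.

Definition enorm (R : realType) (p : 'cV[R]_3) : R := Num.sqrt (dot p p).

Definition sphere2 (R : realType) : set 'cV[R]_3 := [set p | enorm p = 1].

Section hausdorff.
Context {R : realType}.
Local Open Scope ereal_scope.

(* The supremum of the empty set is -oo, hence the maximum with 0. *)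
Definition ediam (C : set 'cV[R]_3) : \bar R :=
  maxe 0 (ereal_sup [set (enorm (p - q)%R)%:E | p in C & q in C]).

Definition delta_cover (delta : R) (A : set 'cV[R]_3) :
    set (nat -> set 'cV[R]_3) :=
  [set C | A `<=` \bigcup_k C k /\ forall k, ediam (C k) <= delta%:E].

(* pi / 4 * d ^ 2 is the area of the disc of diameter d. *)
Definition hausdorff2_delta (delta : R) (A : set 'cV[R]_3) : \bar R :=
  ereal_inf [set \sum_(k <oo) ((pi / 4)%:E * ediam (C k) ^+ 2)
            | C in delta_cover delta A].

(* hausdorff2_delta is nonincreasing in delta, so that the limit as delta
   tends to 0 is a supremum. *)
Definition hausdorff2 (A : set 'cV[R]_3) : \bar R :=
  ereal_sup [set hausdorff2_delta delta A
            | delta in [set delta : R | (0 < delta)%R]].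

Let gauge_ge0 C : 0 <= (pi / 4)%:E * ediam C ^+ 2.
Proof.
by rewrite mule_ge0// ?lee_fin ?divr_ge0 ?pi_ge0// expe_ge0// le_max lexx.
Qed.

Let hausdorff2_delta_ge0 delta A : 0 <= hausdorff2_delta delta A.
Proof.
by apply: le_ereal_inf_tmp => _ [C _ <-]; apply: nneseries_ge0 => n _ _.
Qed.

Let le_hausdorff2_delta delta A B : A `<=` B ->
  hausdorff2_delta delta A <= hausdorff2_delta delta B.
Proof.
move=> AB; apply: ereal_inf_le_tmp => _ [C [BC dC] <-]; exists C => //.
by split=> //; exact: subset_trans BC.
Qed.

Let hausdorff2_delta_sigma_subadditive delta :
  sigma_subadditive (hausdorff2_delta delta).
Proof.
move=> A; have [[i ioo]|] := pselect (exists i, hausdorff2_delta delta (A i) = +oo).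
  rewrite (eseries_pinfty _ _ ioo) ?leey// => n _.
  by rewrite -ltNye (lt_le_trans _ (hausdorff2_delta_ge0 _ _)).
rewrite -forallNE => Aoo; apply/lee_addgt0Pr => e e0.
apply: le_trans (epsilon_trick xpredT
  (fun n => hausdorff2_delta_ge0 delta (A n)) (ltW e0)).
pose w (C : set 'cV[R]_3) : \bar R := (pi / 4)%:E * ediam C ^+ 2.
have [G PG] : {G : nat -> nat -> set 'cV[R]_3 & forall n,
    delta_cover delta (A n) (G n) /\
    \sum_(k <oo) w (G n k) <=
      hausdorff2_delta delta (A n) + (e / (2 ^ n.+1)%:R)%:E}.
  apply: (@choice _ _ (fun n B => delta_cover delta (A n) B /\
    \sum_(k <oo) w (B k) <=
      hausdorff2_delta delta (A n) + (e / (2 ^ n.+1)%:R)%:E)) => n.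
  have en0 : (0 < e / (2 ^ n.+1)%:R)%R by rewrite divr_gt0// ltr0n expn_gt0.
  have /(lb_ereal_inf_adherent en0) : hausdorff2_delta delta (A n) \is a fin_num.
    by rewrite ge0_fin_numE// ltey; apply/eqP; exact: Aoo.
  by move=> [_ [B covB <-] /ltW leB]; exists B.
have w0 x : 0 <= (w \o uncurry G) x by exact: gauge_ge0.
apply: (@le_trans _ _ (\esum_(i in setT) (w \o uncurry G) i)).
  have /card_esym/ppcard_eqP[h] := card_nat2.
  apply: ereal_inf_lbound => /=; exists (uncurry G \o h).
    split=> [t [i _ /(PG i).1.1[j _ Gt]]|k].
      by exists (h^-1%FUN (i, j)) => //=; rewrite invK ?inE.
    by rewrite /= /uncurry; case: (h k) => i j; exact: (PG i).1.2.
  rewrite -(esum_pred_image (w \o uncurry G) _ xpredT) ?[fun=> _]set_true//.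
  by rewrite image_eq.
rewrite (_ : esum _ _ = \sum_(i <oo) \sum_(j <oo) w (G i j)); last first.
  pose J : nat -> set (nat * nat) := fun i => [set (i, j) | j in setT].
  rewrite (_ : setT = \bigcup_k J k); last first.
    by rewrite predeqE => -[a b]; split => // _; exists a => //; exists b.
  rewrite esum_bigcupT /=; last 2 first.
    - apply/trivIsetP => i j _ _ ij.
      rewrite predeqE => -[n m] /=; split => //= -[] [_] _ [<-{n} _].
      by move=> [m' _] [] /esym/eqP; rewrite (negbTE ij).
    - by move=> x; exact: w0.
  rewrite -(image_id [set: nat]) -fun_true esum_pred_image//; last first.
    by move=> n _; apply: esum_ge0 => x _; exact: (w0 x).
  apply: eq_eseriesr => /= j _.
  rewrite -[RHS](@esum_pred_image R _ (w \o uncurry G) (pair j) predT).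
  - by congr esum; rewrite predeqE => -[a b]; split; move=> [i _ <-]; exists i.
  - by move=> n _; exact: w0 (j, n).
  - by move=> ? ? _ _ [].
apply: lee_nneseries => n _ => [_|]; last exact: (PG n).2.
by apply: nneseries_ge0 => m _ _; exact: (w0 (n, m)).
Qed.

Let ediam0 : ediam set0 = 0.
Proof.
rewrite /ediam (_ : [set _ | _ in _ & _ in _] = set0).
  by rewrite ereal_sup0 maxEge leNye.
by apply/seteqP; split=> // x [p].
Qed.

Let hausdorff20 : hausdorff2 set0 = 0.
Proof.
apply/eqP; rewrite eq_le; apply/andP; split.
  apply: ge_ereal_sup => _ [d /= d0 <-]; apply: ereal_inf_lbound => /=.
  exists (fun=> set0); first by split=> // k; rewrite ediam0 lee_fin ltW.
  by apply: eseries0 => k _ _; rewrite ediam0 !mule0.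
apply: le_trans (hausdorff2_delta_ge0 1 set0) _.
by apply: ereal_sup_ubound; exists 1%R => //=; exact: ltr01.
Qed.

Let hausdorff2_ge0 A : 0 <= hausdorff2 A.
Proof.
apply: le_trans (hausdorff2_delta_ge0 1 A) _.
by apply: ereal_sup_ubound; exists 1%R => //=; exact: ltr01.
Qed.

Let le_hausdorff2 : {homo hausdorff2 : A B / A `<=` B >-> A <= B}.
Proof.
move=> A B AB; apply: ge_ereal_sup => _ [d /= d0 <-].
apply: le_trans (le_hausdorff2_delta d AB) _.
by apply: ereal_sup_ubound; exists d.
Qed.

Let hausdorff2_sigma_subadditive : sigma_subadditive hausdorff2.
Proof.
move=> A; apply: ge_ereal_sup => _ [d /= d0 <-].
apply: le_trans (@hausdorff2_delta_sigma_subadditive d A) _.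
apply: lee_nneseries => n _ => [_|]; first exact: hausdorff2_delta_ge0.
by apply: ereal_sup_ubound; exists d.
Qed.

HB.instance Definition _ := isOuterMeasure.Build R 'cV[R]_3 hausdorff2
  hausdorff20 hausdorff2_ge0 le_hausdorff2 hausdorff2_sigma_subadditive.

End hausdorff.

Definition hausdorff2_outer (R : realType) : {outer_measure set 'cV[R]_3 -> \bar R} :=
  @hausdorff2 R.

(* The Hausdorff measure, on the sigma-algebra of its Caratheodory-measurable
   sets (the Borel sets and the subsets of null Borel sets among them). *)
Definition dS (R : realType) :
    {measure set (caratheodory_type (hausdorff2_outer R)) -> \bar R} :=
  (hausdorff2_outer R : set (caratheodory_type (hausdorff2_outer R)) -> \bar R).

Section model.
Context {R : realType}.
Implicit Types (f : 'cV[R]_3 -> R) (A B Q L : 'M[R]_3) (p q : 'cV[R]_3).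

Definition sym0 : set 'M[R]_3 := [set A | A^T = A /\ \tr A = 0].

Definition frob A B : R := \tr (A *m B).

Definition vmin A : R := inf [set a | eigenvalue A a].

Definition physQ : set 'M[R]_3 := [set Q | sym0 Q /\ - (1 / 3) < vmin Q].

Definition tless p : 'M[R]_3 := p *m p^T - (1 / 3)%:M.

(* A density on the sphere is a function on R^3 whose values off the sphere
   play no role. *)
Definition density : set ('cV[R]_3 -> R) := [set f |
  [/\ (dS R).-integrable (@sphere2 R) (EFin \o f),
      {ae dS R, forall p, sphere2 p -> 0 <= f p}
    & \int[dS R]_(p in @sphere2 R) f p = 1]].

Definition moment f : 'M[R]_3 :=
  \matrix_(i, j) \int[dS R]_(p in @sphere2 R) (f p * tless p i j).

(* lne is -oo on nonpositive reals, 0 * -oo = 0 in \bar R, and ln 0 = 0 in R. *)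
Definition energy (eta : R) f : \bar R :=
  (\int[dS R]_(p in @sphere2 R)
    ((f p * ln (f p))%:E -
     (f p)%:E *
       lne (\int[dS R]_(q in @sphere2 R) ((dot p q ^+ 2 - 1 / 3) * f q)
            - eta)%R%:E))%E.

Definition densities_at Q : set ('cV[R]_3 -> R) :=
  [set f | density f /\ moment f = Q].

Definition J (eta : R) Q : \bar R :=
  ereal_inf [set energy eta f | f in densities_at Q].

Definition domJ (eta : R) : set 'M[R]_3 :=
  [set Q | physQ Q /\ (J eta Q < +oo)%E].

Definition weight (eta : R) Q p : R := Num.max (dot (Q *m p) p - eta) 0.

Definition quotient (eta : R) f Q p : R :=
  if eta < dot (Q *m p) p then f p / (dot (Q *m p) p - eta) else 0.

Definition dual_objective (eta : R) Q L : R :=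
  frob Q L -
  ln (\int[dS R]_(p in @sphere2 R) (expR (dot (L *m p) p) * weight eta Q p)).

Definition is_argmax (T : Type) (X : set T) (phi : T -> R) (x : T) : Prop :=
  X x /\ forall y, X y -> phi y <= phi x.

(* The inner maximum is attained for every Q0 in the domain of J, and Q
   minimises its value. *)
Definition saddle_solution (eta : R) Q L : Prop :=
  [/\ domJ eta Q,
      is_argmax sym0 (dual_objective eta Q) L
    & forall Q0, domJ eta Q0 ->
        exists2 L0, is_argmax sym0 (dual_objective eta Q0) L0
                  & dual_objective eta Q L <= dual_objective eta Q0 L0].

End model.

(* Main.v *)
Require Import Defs.
From mathcomp Require Import all_boot all_order all_algebra.
From mathcomp Require Import all_classical all_reals all_analysis.
From mathcomp Require Import measurable_realfun lra.
Import Order.TTheory GRing.Theory Num.Theory.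
Import numFieldNormedType.Exports.

Set Implicit Arguments.
Unset Strict Implicit.
Unset Printing Implicit Defensive.

Local Open Scope classical_set_scope.
Local Open Scope ring_scope.

(* With its moment Q fixed, u(p) = Q p . p - eta is a fixed weight, and the pointwise
   inequality x ln (x / y) >= x - y with x = f and y the Gibbs density
   exp (L p . p) max(u, 0) / Z(Q, L) bounds the energy of f below by the dual
   objective Q . L - ln Z(Q, L), with equality only for f = y. If L is a critical
   point of the dual objective, the Gibbs density has moment Q and its energy is the
   dual objective; so a minimiser is the Gibbs density of the maximising L. The dual
   objective is coercive, and its maximiser unique, because a quadric is a null set
   of the sphere: otherwise infinitely many rotated copies of it would share a point
   (the sphere has finite measure), so that the quadric would contain a whole circle
   around each coordinate axis, which forces its matrix to vanish.

   For the formula for L, let L_t be a critical point near L of the dual objective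
   at Q + t H, which exists since the maximum at Q is strict. Its Gibbs density is a
   competitor of f, so that t H . L_t >= ln (Z(Q + t H, L_t) / Z(Q, L_t)), and Z is
   convex in Q; the limit t -> 0 gives H . L >= H . int (f / u) (p (x) p - I / 3) for
   every H. *)

(** Perturbing f itself is awkward: f vanishes where u <= 0, and any change of f moves this region
    through Q. Competitors are therefore taken among Gibbs densities, which are nonnegative and have
    the right support by construction. The price is that the energy of a Gibbs density at Q + t H is
    known only if its own moment is Q + t H, which forces the search for the critical points L_t.

    The function max(u, 0) is not differentiable in Q where u = 0. Convexity of Z replaces the
    derivative by a one-sided bound with a subgradient that vanishes there, and using the resulting
    inequality for both H and -H turns it into an equality.

    The bound eta < 2/3 provides a density of finite energy. Finite energy is what makes f vanish
    where u <= 0 and hence Z positive. *)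

Definition i0 : 'I_3 := @Ordinal 3 0 isT.
Definition i1 : 'I_3 := @Ordinal 3 1 isT.
Definition i2 : 'I_3 := @Ordinal 3 2 isT.

Lemma sum_I3 (V : nmodType) (F : 'I_3 -> V) : \sum_i F i = F i0 + F i1 + F i2.
Proof.
rewrite !big_ord_recl big_ord0 addr0 addrA.
by congr (_ + _ + _); congr F; apply: val_inj.
Qed.

Lemma I3_ind (P : 'I_3 -> Prop) : P i0 -> P i1 -> P i2 -> forall i, P i.
Proof.
move=> P0 P1 P2 [[|[|[|//]]] h].
- by rewrite (_ : Ordinal h = i0)//; apply: val_inj.
- by rewrite (_ : Ordinal h = i1)//; apply: val_inj.
- by rewrite (_ : Ordinal h = i2)//; apply: val_inj.
Qed.

Section euclid.
Context {R : realType}.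
Implicit Types p q : 'cV[R]_3.

Lemma dotE p q : dot p q = p i0 0 * q i0 0 + p i1 0 * q i1 0 + p i2 0 * q i2 0.
Proof. by rewrite /dot mxE sum_I3 !mxE. Qed.

Lemma sphere2P p : sphere2 p <-> dot p p = 1.
Proof.
rewrite /sphere2 /= /enorm; split=> [h|->]; last exact: sqrtr1.
have d0 : 0 <= dot p p.
  by rewrite dotE -!expr2 !addr_ge0 ?sqr_ge0.
by rewrite -(sqr_sqrtr d0) h expr1n.
Qed.

Lemma normr_coord_le p i : `|p i 0| <= enorm p.
Proof.
rewrite -sqrtr_sqr ler_wsqrtr// dotE.
have h0 := sqr_ge0 (p i0 0); have h1 := sqr_ge0 (p i1 0).
have h2 := sqr_ge0 (p i2 0).
by elim/I3_ind: i; rewrite -!expr2; lra.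
Qed.

Lemma sphere2_coord_le1 p i : sphere2 p -> `|p i 0| <= 1.
Proof. by move=> <-; exact: normr_coord_le. Qed.

Lemma enorm0 : enorm (0 : 'cV[R]_3) = 0.
Proof. by rewrite /enorm dotE !mxE !mulr0 !addr0 sqrtr0. Qed.

End euclid.

(** * The two-dimensional Hausdorff measure *)

Section hausdorff.
Context {R : realType}.
Local Open Scope ereal_scope.
Implicit Types (A B C X : set 'cV[R]_3) (p q : 'cV[R]_3).

Lemma ediam_ge0 C : 0 <= ediam C.
Proof. by rewrite /ediam le_max lexx. Qed.

Lemma gauge_ge0 C : 0 <= (pi / 4)%:E * ediam C ^+ 2.
Proof. by rewrite mule_ge0// ?lee_fin ?divr_ge0 ?pi_ge0// expe_ge0// ediam_ge0. Qed.

Lemma ediam_le C (d : R) : (0 <= d)%R ->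
  (forall p q, C p -> C q -> (enorm (p - q) <= d)%R) -> ediam C <= d%:E.
Proof.
move=> d0 h; rewrite ge_max lee_fin d0/=; apply: ge_ereal_sup => _ [p Cp [q Cq <-]].
by rewrite lee_fin h.
Qed.

Lemma enorm_le_ediam C p q : C p -> C q -> (enorm (p - q))%:E <= ediam C.
Proof.
by move=> Cp Cq; rewrite le_max; apply/orP; right; apply: ereal_sup_ubound;
  exists p => //; exists q.
Qed.

Lemma ediam_set0 : ediam (@set0 'cV[R]_3) = 0.
Proof.
by apply/eqP; rewrite eq_le ediam_ge0 andbT (@ediam_le _ 0%R).
Qed.

Lemma gauge_eq0 C : ediam C = 0 -> (pi / 4)%:E * ediam C ^+ 2 = 0.
Proof. by move=> ->; rewrite expeS mul0e mule0. Qed.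

Lemma gauge_set0 : (pi / 4)%:E * ediam (@set0 'cV[R]_3) ^+ 2 = 0.
Proof. exact/gauge_eq0/ediam_set0. Qed.

Lemma hausdorff2_delta_nincr (d e : R) A : (d <= e)%R ->
  hausdorff2_delta e A <= hausdorff2_delta d A.
Proof.
move=> de; apply: ereal_inf_le_tmp => _ [C [AC dC] <-]; exists C => //.
by split=> // k; rewrite (le_trans (dC k))// lee_fin.
Qed.

Lemma hausdorff2_delta_le (d : R) A : (0 < d)%R -> hausdorff2_delta d A <= hausdorff2 A.
Proof. by move=> d0; apply: ereal_sup_ubound; exists d. Qed.

Lemma hausdorff2_set1 p : hausdorff2 [set p] = 0.
Proof.
apply/eqP; rewrite eq_le (outer_measure_ge0 (hausdorff2_outer R)) andbT.
apply: ge_ereal_sup => _ [d /= d0 <-]; apply: ereal_inf_lbound => /=.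
have d1 : ediam [set p] = 0.
  apply/eqP; rewrite eq_le ediam_ge0 andbT (@ediam_le _ 0%R)//.
  by move=> _ _ /= -> ->; rewrite subrr enorm0.
exists (fun=> [set p]); last by apply: eseries0 => k _ _; exact: gauge_eq0.
by split=> [q ->|k]; [exists 0%N | rewrite d1 lee_fin ltW].
Qed.

(** A set of diameter below r cannot meet both A and B, so a fine cover of the union splits into a
    cover of A and a cover of B. *)
Lemma hausdorff2_separated A B (r : R) : (0 < r)%R ->
  (forall p q, A p -> B q -> (r <= enorm (p - q))%R) ->
  hausdorff2 A + hausdorff2 B <= hausdorff2 (A `|` B).
Proof.
move=> r0 AB.
have delta (d : R) : (0 < d)%R -> (d < r)%R ->
    hausdorff2_delta d A + hausdorff2_delta d B <= hausdorff2_delta d (A `|` B).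
  move=> d0 dr; apply: le_ereal_inf_tmp => _ [C [covC dC] <-].
  (* Sets that miss X are replaced by the empty set, so both covers keep the index k and the sums
     compare termwise. *)
  pose res X k := if pselect (C k `&` X !=set0) then C k else set0.
  have resP X : X `<=` A `|` B -> hausdorff2_delta d X <=
      \sum_(k <oo) (pi / 4)%:E * ediam (res X k) ^+ 2.
    move=> XAB; apply: ereal_inf_lbound; exists (res X) => //; split.
      move=> p Xp; have [k _ Ckp] := covC _ (XAB _ Xp); exists k => //.
      by rewrite /res; case: pselect => // -[]; exists p.
    move=> k; rewrite /res; case: pselect => ?; first exact: dC.
    by rewrite ediam_set0 lee_fin ltW.
  apply: (@le_trans _ _ (\sum_(k <oo) (pi / 4)%:E * ediam (res A k) ^+ 2 +
      \sum_(k <oo) (pi / 4)%:E * ediam (res B k) ^+ 2)).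
    by apply: leeD; apply: resP => p; [left|right].
  rewrite -nneseriesD; last 2 first.
  - by move=> k _ _; exact: gauge_ge0.
  - by move=> k _ _; exact: gauge_ge0.
  apply: lee_nneseries => k _ => [_|]; first by rewrite adde_ge0// gauge_ge0.
  rewrite /res; case: pselect => [[p [Cp Ap]]|?]; last first.
    rewrite gauge_set0 add0e; case: pselect => ?; first by [].
    by rewrite gauge_set0 gauge_ge0.
  case: pselect => [[q [Cq Bq]]|?]; last by rewrite gauge_set0 adde0.
  have := le_trans (enorm_le_ediam Cp Cq) (dC k).
  by rewrite lee_fin leNgt (lt_le_trans dr (AB _ _ Ap Bq)).
have AABB X (d : R) : (0 < d)%R -> hausdorff2_delta d X <= hausdorff2 X by exact: hausdorff2_delta_le.
have ge0 d X : 0 <= hausdorff2_delta d X.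
  by apply: le_ereal_inf_tmp => _ [C _ <-]; apply: nneseries_ge0 => n _ _; exact: gauge_ge0.
(* Two independent scales, because the suprema defining the measures of A and B are taken one after
   the other. *)
have key (d e : R) : (0 < d)%R -> (0 < e)%R ->
    hausdorff2_delta d A + hausdorff2_delta e B <= hausdorff2 (A `|` B).
  move=> d0 e0; pose m := Num.min (Num.min d e) (r / 2)%R.
  have m0 : (0 < m)%R by rewrite !lt_min d0 e0 divr_gt0.
  have mr : (m < r)%R by rewrite gt_min; apply/orP; right; lra.
  apply: le_trans (le_trans (delta _ m0 mr) (AABB _ _ m0)).
  by apply: leeD; apply: hausdorff2_delta_nincr; rewrite !ge_min lexx ?orbT.
have hAB0 X : 0 <= hausdorff2 X by exact: (outer_measure_ge0 (hausdorff2_outer R)).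
have [->|ABoo] := eqVneq (hausdorff2 (A `|` B)) +oo; first by rewrite leey.
have ABf : hausdorff2 (A `|` B) \is a fin_num by rewrite ge0_fin_numE// ltey.
have fin (d e : R) : (0 < d)%R -> (0 < e)%R ->
    hausdorff2_delta d A \is a fin_num /\ hausdorff2_delta e B \is a fin_num.
  move=> d0 e0; have := key _ _ d0 e0 => h.
  split; rewrite ge0_fin_numE//; apply: le_lt_trans (_ : hausdorff2 (A `|` B) < +oo);
    rewrite ?ltey//; apply: le_trans h.
    by rewrite leeDl.
  by rewrite leeDr.
have step (e : R) : (0 < e)%R -> hausdorff2 A <= hausdorff2 (A `|` B) - hausdorff2_delta e B.
  move=> e0; apply: ge_ereal_sup => _ [d /= d0 <-].
  by rewrite leeBrDr ?key//; exact: (fin _ _ d0 e0).2.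
have fA : hausdorff2 A \is a fin_num.
  rewrite ge0_fin_numE//; apply: le_lt_trans (step _ ltr01) _.
  by rewrite ltey_eq fin_numB ABf (fin _ _ ltr01 ltr01).2.
rewrite addeC -leeBrDr//; apply: ge_ereal_sup => _ [e /= e0 <-].
rewrite leeBrDr// addeC -leeBrDr ?step//; exact: (fin _ _ e0 e0).2.
Qed.

End hausdorff.

Section caratheodory_criterion.
Context {R : realType}.
Local Open Scope ereal_scope.
Implicit Types (A B C X : set 'cV[R]_3) (p q : 'cV[R]_3).

Lemma hausdorff2_ge0 A : 0 <= hausdorff2 A.
Proof. exact: (outer_measure_ge0 (hausdorff2_outer R)). Qed.

Lemma le_hausdorff2 A B : A `<=` B -> hausdorff2 A <= hausdorff2 B.
Proof. exact: (le_outer_measure (hausdorff2_outer R)). Qed.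

Lemma lee_nneseries_of_partial (u : nat -> \bar R) (x : \bar R) :
  (forall k, 0 <= u k) -> (forall n, \sum_(k < n) u k <= x) ->
  \sum_(k <oo) u k <= x.
Proof.
move=> u0 h; apply: lime_le; first by apply: is_cvg_nneseries => *; exact: u0.
by apply: nearW => n; rewrite big_mkord.
Qed.

(* The layers of a set between consecutive levels c + 1/(n+1) of phi are
   separated from all but their neighbours, so their measures are summable. *)
Lemma hausdorff2_sublevel (phi : 'cV[R]_3 -> R) (c : R) :
  (forall p q, `|phi p - phi q| <= enorm (p - q))%R ->
  (hausdorff2_outer R).-caratheodory [set p | (phi p <= c)%R].
Proof.
move=> lip; apply: le_caratheodory_measurable => X.
rewrite /= -/(hausdorff2 X).
have [->|Xoo] := eqVneq (hausdorff2 X) +oo; first by rewrite leey.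
have Xfin : hausdorff2 X \is a fin_num.
  by rewrite ge0_fin_numE ?hausdorff2_ge0// ltey.
set H := [set p | _]; set mu : set 'cV[R]_3 -> \bar R := hausdorff2.
pose l (n : nat) : R := (c + n.+1%:R^-1)%R.
have ln n : (l n.+1 < l n)%R by rewrite ltrD2l ltf_pV2 ?posrE// ltr_nat.
have lc n : (c < l n)%R by rewrite ltrDl invr_gt0.
pose E n := X `&` [set p | (l n < phi p)%R].
pose A n := X `&` [set p | (l n.+1 < phi p <= l n)%R].
have fin Y : Y `<=` X -> mu Y \is a fin_num.
  move=> YX; rewrite ge0_fin_numE ?hausdorff2_ge0//.
  by apply: le_lt_trans (le_hausdorff2 YX) _; rewrite ltey.
have EX n : E n `<=` X by exact: subIsetl.
have AX n : A n `<=` X by exact: subIsetl.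
pose e n := fine (mu (E n)); pose a n := fine (mu (A n)).
have eE n : mu (E n) = (e n)%:E by rewrite fineK ?fin.
have aE n : mu (A n) = (a n)%:E by rewrite fineK ?fin.
have sep Y Z (s t : R) : (s < t)%R -> Y `<=` [set p | (phi p <= s)%R] ->
    Z `<=` [set p | (t <= phi p)%R] -> mu Y + mu Z <= mu (Y `|` Z).
  move=> st Ys Zt; apply: (@hausdorff2_separated _ _ _ (t - s)%R).
    by rewrite subr_gt0.
  move=> p q /Ys /= hp /Zt /= hq; apply: le_trans (lip p q).
  by rewrite distrC ler_normr; apply/orP; left; rewrite lerB.
have HE n : mu (X `&` H) + (e n)%:E <= mu X.
  rewrite -eE; apply: le_trans (_ : mu ((X `&` H) `|` E n) <= _).
    by apply: (sep _ _ c (l n)) => // p [_ /=] //; exact: ltW.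
  by apply: le_hausdorff2; rewrite subUset; split; [exact: subIsetl|exact: EX].
(* The layer [A n.+1] lies below level [l n.+1], [E n] lies above [l n], and both are contained in
   [E n.+2]. *)
have Ae n : (a n.+1 + e n <= e n.+2)%R.
  rewrite -lee_fin EFinD -aE -!eE.
  apply: le_trans (_ : mu (A n.+1 `|` E n) <= _).
    by apply: (sep _ _ (l n.+1) (l n)) => // p [_ /=] => [/andP[]//|/ltW].
  apply: le_hausdorff2 => p [[Xp /= /andP[h _]]|[Xp /= h]]; split => //=.
  by apply: lt_trans h; apply: (lt_trans (ln _)).
have emono n : (e n <= e n.+1)%R.
  rewrite -lee_fin -!eE; apply: le_hausdorff2 => p [Xp /= h]; split => //=.
  exact: lt_trans h.
(* The bound [a m.+1 <= e m.+2 - e m] telescopes in steps of two, which leaves two terms at each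
   end. *)
have Asum n N : (\sum_(k < N) a (k + n.+1)%N <= e (N + n)%N + e (N + n).+1 - e n - e n.+1)%R.
  elim: N => [|N ih]; first by rewrite big_ord0 add0n; lra.
  rewrite big_ord_recr/= (_ : (N + n.+1)%N = (N + n).+1) ?addnS//.
  by have := Ae (N + n)%N; rewrite addSn; lra.
pose s := sup (range e).
have hs : has_sup (range e).
  split; first by exists (e 0%N), 0%N.
  exists (fine (mu X)) => _ [n _ <-].
  by rewrite fine_le ?fin//; exact: le_hausdorff2.
have es n : (e n <= s)%R by apply: ub_le_sup; [exact: hs.2|exists n].
have outer n : mu (X `&` ~` H) <= (2 * s - e n)%:E.
  have cov : X `&` ~` H `<=` E n.+1 `|` \bigcup_k A (k + n.+1)%N.
    move=> p [Xp /= /negP]; rewrite -ltNge => cp.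
    have [h|h] := ltP (l n.+1) (phi p); first by left.
    right.
    (* Since phi p exceeds c, it exceeds some level; going back up through the levels from there, a
       layer containing p is met. *)
    have [m hm] : exists m, (l (m + n.+1)%N < phi p)%R.
      exists (Num.truncn (phi p - c)^-1).
      rewrite -ltrBrDl invf_plt ?posrE ?subr_gt0//.
      apply: lt_le_trans (truncnS_gt _) _.
      by rewrite ler_nat ltnS leq_addr.
    elim: m hm => [|m ih] hm; first by move: hm; rewrite add0n ltNge h.
    have [h'|h'] := ltP (l (m + n.+1)%N) (phi p); first exact: ih.
    by exists m => //; split => //=; rewrite h' andbT -addSn.
  apply: le_trans (le_hausdorff2 cov) _.
  apply: le_trans (outer_measureU2 (hausdorff2_outer R) _ _) _.
  rewrite /= -/(mu _) eE.
  have -> : (2 * s - e n)%R = (e n.+1 + (2 * s - e n - e n.+1))%R by lra.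
  rewrite EFinD leeD2l//.
  apply: le_trans (outer_measure_sigma_subadditive (hausdorff2_outer R) _) _.
  apply: lee_nneseries_of_partial => [k|N]; first exact: hausdorff2_ge0.
  rewrite (eq_bigr (fun k : 'I_N => (a (k + n.+1)%N)%:E)); last first.
    by move=> k _; exact: aE.
  rewrite sumEFin lee_fin; apply: le_trans (Asum n N) _.
  by have := es (N + n)%N; have := es (N + n).+1; lra.
have Hf : mu (X `&` H) \is a fin_num by rewrite fin.
have HCf : mu (X `&` ~` H) \is a fin_num by rewrite fin.
rewrite -/(mu _) -/(mu (X `&` ~` H)) -/(mu X).
rewrite -(fineK Hf) -(fineK HCf) -(fineK (fin X (@subset_refl _ X))).
rewrite -EFinD lee_fin; apply/ler_addgt0Pr => eps eps0.
(* [HE] and [outer] add up to mu X + 2 (s - e n), so e n has to be within eps / 2 of s. *)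
have eps2 : (0 < eps / 2)%R by rewrite divr_gt0.
have [_ [n _ <-] hn] := sup_adherent eps2 hs.
have h1 := HE n; have h2 := outer n.
move: h1 h2; rewrite -(fineK Hf) -(fineK HCf) -(fineK (fin X (@subset_refl _ X))).
by rewrite -EFinD !lee_fin -/s in hn *; lra.
Qed.

End caratheodory_criterion.

Section isometry.
Context {R : realType}.
Local Open Scope ereal_scope.
Implicit Types (A B C X : set 'cV[R]_3) (p q : 'cV[R]_3).

Lemma le_gauge A B : ediam A <= ediam B ->
  (pi / 4)%:E * ediam A ^+ 2 <= (pi / 4)%:E * ediam B ^+ 2.
Proof.
move=> AB; apply: lee_wpmul2l; first by rewrite lee_fin divr_ge0 ?pi_ge0.
by rewrite !expe2; apply: lee_pmul; rewrite ?ediam_ge0.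
Qed.

(** The preimages of a cover under an expanding map form a cover by sets of no larger diameter. *)
Lemma hausdorff2_preimage_le (T : 'cV[R]_3 -> 'cV[R]_3) A :
  (forall p q, enorm (p - q) <= enorm (T p - T q))%R ->
  hausdorff2 (T @^-1` A) <= hausdorff2 A.
Proof.
move=> Tge; apply: ge_ereal_sup => _ [d /= d0 <-].
apply: le_trans (hausdorff2_delta_le A d0).
apply: le_ereal_inf_tmp => _ [C [AC dC] <-].
have dT k : ediam (T @^-1` C k) <= ediam (C k).
  rewrite ge_max ediam_ge0/=; apply: ge_ereal_sup => _ [p Cp [q Cq <-]].
  by apply: le_trans (@enorm_le_ediam _ (C k) (T p) (T q) Cp Cq); rewrite lee_fin.
apply: (@le_trans _ _ (\sum_(k <oo) (pi / 4)%:E * ediam (T @^-1` C k) ^+ 2)).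
  apply: ereal_inf_lbound; exists (fun k => T @^-1` C k) => //; split.
    by move=> p /AC [k _ h]; exists k.
  by move=> k; apply: (le_trans (dT k)); exact: dC.
by apply: lee_nneseries => k _ => [_|]; [exact: gauge_ge0|exact: le_gauge].
Qed.

(** The reverse inequality is the same estimate for [T'], which is an isometry too. *)
Lemma hausdorff2_isometry (T T' : 'cV[R]_3 -> 'cV[R]_3) A : cancel T' T ->
  (forall p q, enorm (T p - T q) = enorm (p - q)) ->
  hausdorff2 (T @^-1` A) = hausdorff2 A.
Proof.
move=> TK Tiso; apply/eqP; rewrite eq_le; apply/andP; split.
  by apply: hausdorff2_preimage_le => p q; rewrite Tiso.
have AE : A = T' @^-1` (T @^-1` A).
  by apply/funext => p; rewrite /preimage /mkset TK.
rewrite {1}AE.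
by apply: hausdorff2_preimage_le => p q; rewrite -(Tiso (T' p)) !TK.
Qed.

End isometry.

(** * Finite area of the sphere *)

Section cover.
Context {R : realType}.
Implicit Types (A B C X : set 'cV[R]_3) (p q : 'cV[R]_3).

(** The cyclic successor, so that one formula treats the three coordinate axes. *)
Definition nxt (i : 'I_3) : 'I_3 := if i == i0 then i1 else if i == i1 then i2 else i0.

Lemma dot_nxt p q i : dot p q =
  p i 0 * q i 0 + p (nxt i) 0 * q (nxt i) 0 + p (nxt (nxt i)) 0 * q (nxt (nxt i)) 0.
Proof. by rewrite dotE; elim/I3_ind: i => /=; lra. Qed.

(* The points of the sphere whose i-th coordinate has sign s and is at least
   1/2 in modulus, with the two others in given intervals of length 1/n. *)
Definition cell n (k : 'I_3 * bool * ('I_(n + n).+1 * 'I_(n + n).+1)) : set 'cV[R]_3 :=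
  [set p | [/\ sphere2 p, 1 / 2 <= (-1) ^+ k.1.2 * p k.1.1 0,
    Num.truncn (n%:R * (p (nxt k.1.1) 0 + 1)) = k.2.1 &
    Num.truncn (n%:R * (p (nxt (nxt k.1.1)) 0 + 1)) = k.2.2]].

Lemma truncn_close (n : nat) (x y : R) : (0 < n)%N -> -1 <= x -> -1 <= y ->
  Num.truncn (n%:R * (x + 1)) = Num.truncn (n%:R * (y + 1)) ->
  `|x - y| <= n%:R^-1.
Proof.
move=> n0 hx hy exy.
have nn : (0 : R) < n%:R by rewrite ltr0n.
have x0 : 0 <= n%:R * (x + 1) by rewrite mulr_ge0// ?ler0n//; lra.
have y0 : 0 <= n%:R * (y + 1) by rewrite mulr_ge0// ?ler0n//; lra.
have := truncn_itv x0; have := truncn_itv y0; rewrite exy.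
set m := Num.truncn _; rewrite -[m.+1]addn1 natrD => /andP[h1 h2] /andP[h3 h4].
rewrite -[leRHS]mulr1 -ler_pdivrMl ?invr_gt0// invrK -(gtr0_norm nn) -normrM.
by rewrite ler_norml; apply/andP; split; lra.
Qed.

(** Let x be the large coordinate and h = 1/n. As both points lie on the sphere, (x - x')(x + x') =
    (y' - y)(y' + y) + (z' - z)(z' + z) is at most 4 h in modulus, while |x + x'| >= 1 because x and
    x' have the same sign. Hence |x - x'| <= 4 h, and 16 + 1 + 1 <= 25. *)
Lemma cell_diam n k p q : (0 < n)%N -> cell (n := n) k p -> cell k q ->
  enorm (p - q) <= 5 / n%:R.
Proof.
move: k => [[i s] [a b]] n0 [/= Sp hp pa pb] [/= Sq hq qa qb].
have coordge (r : 'cV[R]_3) j : sphere2 r -> -1 <= r j 0.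
  by move=> /(sphere2_coord_le1 j); rewrite ler_norml => /andP[].
have coordle (r : 'cV[R]_3) j : sphere2 r -> r j 0 <= 1.
  by move=> /(sphere2_coord_le1 j); rewrite ler_norml => /andP[].
have := @truncn_close n (p (nxt i) 0) (q (nxt i) 0) n0 (coordge p _ Sp) (coordge q _ Sq).
rewrite pa qa => /(_ erefl).
have := @truncn_close n (p (nxt (nxt i)) 0) (q (nxt (nxt i)) 0) n0
  (coordge p _ Sp) (coordge q _ Sq).
rewrite pb qb => /(_ erefl).
have h0 : (0 : R) <= n%:R^-1 by rewrite invr_ge0 ler0n.
have := coordle p (nxt i) Sp; have := coordle q (nxt i) Sq.
have := coordge p (nxt i) Sp; have := coordge q (nxt i) Sq.
have := coordle p (nxt (nxt i)) Sp; have := coordle q (nxt (nxt i)) Sq.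
have := coordge p (nxt (nxt i)) Sp; have := coordge q (nxt (nxt i)) Sq.
move: Sp Sq => /sphere2P; rewrite (dot_nxt p p i) => Sp.
move=> /sphere2P; rewrite (dot_nxt q q i) => Sq.
rewrite /enorm (dot_nxt _ _ i) !mxE.
move: hp hq Sp Sq.
move: (p i 0) (q i 0) (p (nxt i) 0) (q (nxt i) 0) (p (nxt (nxt i)) 0)
  (q (nxt (nxt i)) 0) (n%:R^-1) h0 => x x' y y' z z' h h0.
move=> hp hq Sp Sq z1 z2 z3 z4 y1 y2 y3 y4.
rewrite !ler_norml => /andP[dz1 dz2] /andP[dy1 dy2].
have dx : `|x - x'| <= 4 * h.
  have sum1 : 1 <= `|x + x'|.
    by case: s hp hq; rewrite ?expr1 ?expr0 => hp hq; rewrite ler_normr;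
      apply/orP; [right|left]; lra.
  have h4 : `|x - x'| * `|x + x'| <= 4 * h.
    rewrite -normrM (_ : (x - x') * (x + x') = (y' - y) * (y' + y) + (z' - z) * (z' + z)); last lra.
    rewrite (le_trans (ler_normD _ _))// (_ : 4 * h = h * 2 + h * 2); last lra.
    rewrite !normrM; apply: lerD; apply: ler_pM => //; rewrite ler_norml; apply/andP; split; lra.
  apply: le_trans h4; rewrite ler_peMr//.
rewrite -[leRHS]ger0_norm ?mulr_ge0// -sqrtr_sqr ler_wsqrtr//.
have dx2 : (x - x') * (x - x') <= 16 * (h * h).
  rewrite -expr2 -real_normK ?num_real// expr2.
  rewrite (_ : 16 * (h * h) = (4 * h) * (4 * h)); last lra.
  exact: ler_pM.
have sq (u : R) : - h <= u -> u <= h -> u * u <= h * h.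
  move=> u1 u2; rewrite -expr2 -real_normK ?num_real// expr2.
  by apply: ler_pM => //; rewrite ler_norml u1.
have dy2' := sq _ dy1 dy2; have dz2' := sq _ dz1 dz2.
have hh : 0 <= h * h by rewrite mulr_ge0.
rewrite !expr2; lra.
Qed.

Lemma sphere2_cell n p : (0 < n)%N -> sphere2 p -> exists k, @cell n k p.
Proof.
move=> n0 Sp.
have [i hi] : exists i, 1 / 2 <= `|p i 0|.
  apply: contrapT => /forallNP h.
  have lt j : p j 0 * p j 0 < 1 / 4.
    have := h j; move=> /negP; rewrite -ltNge => hj.
    rewrite -expr2 -real_normK ?num_real// expr2.
    rewrite (_ : 1 / 4 = (1 / 2) * (1 / 2)); last lra.
    by apply: ltr_pM.
  have := lt i0; have := lt i1; have := lt i2.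
  by move/sphere2P : Sp; rewrite dotE; lra.
(* A coordinate equal to 1 has index 2 n, hence the 2 n + 1 possible indices. *)
have bd j : (Num.truncn (n%:R * (p j 0 + 1))%R < (n + n).+1)%N.
  have := sphere2_coord_le1 j Sp; rewrite ler_norml => /andP[h1 h2].
  rewrite ltnS truncn_le_nat; apply: le_lt_trans (_ : (n + n)%:R < _).
    rewrite natrD (_ : n%:R + n%:R = n%:R * 2); last lra.
    by rewrite ler_wpM2l ?ler0n//; lra.
  by rewrite ltr_nat.
exists (i, p i 0 < 0, (Ordinal (bd (nxt i)), Ordinal (bd (nxt (nxt i))))).
split => //=; case: (ltP (p i 0) 0) hi => h.
  by rewrite ltr0_norm//; lra.
by rewrite ger0_norm//; lra.
Qed.

Lemma sphere2_cover n : (0 < n)%N -> exists C : nat -> set 'cV[R]_3,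
  [/\ @sphere2 R `<=` \bigcup_k C k,
      forall k, (54 * n ^ 2 <= k)%N -> C k = set0,
      forall k p, C k p -> sphere2 p &
      forall k p q, C k p -> C k q -> enorm (p - q) <= 5 / n%:R].
Proof.
move=> n0; pose K : finType := ('I_3 * bool * ('I_(n + n).+1 * 'I_(n + n).+1))%type.
pose C k := if onth (enum K) k is Some x then @cell n x else set0.
exists C; split.
- move=> p /(sphere2_cell n0) [x hx].
  have /onthP[k kx] : x \in enum K by rewrite mem_enum.
  by exists k => //; rewrite /C kx.
- move=> k hk; rewrite /C onth_default// -cardE /= !card_prod card_bool !card_ord.
  (* 3 axes, 2 signs, and (2 n + 1)^2 <= (3 n)^2 pairs of indices. *)
  apply: leq_trans hk; have -> : (54 * n ^ 2 = 3 * 2 * (3 * n * (3 * n)))%N.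
    by rewrite mulnn expnMn mulnA.
  have n3 : (n + n < 3 * n)%N by rewrite !mulSn mul0n addn0 addnA -addn1 leq_add2l.
  by rewrite leq_mul2l leq_mul.
- by move=> k p; rewrite /C; case: onth => // x [].
- by move=> k p q; rewrite /C; case: onth => // x; exact: cell_diam.
Qed.

(** There are at most 54 n^2 cells, each contributing at most (pi / 4)(5 / n)^2: the total is
    bounded independently of n, which may grow as delta tends to 0. *)
Lemma hausdorff2_sphere_lty : (hausdorff2 (@sphere2 R) < +oo)%E.
Proof.
apply: le_lt_trans (_ : (54 * 25 * pi)%:E < _)%E; last exact: ltry.
apply: ge_ereal_sup => _ [d /= d0 <-].
pose n := (Num.truncn (5 / d)).+1.
have n0 : (0 < n)%N by [].
have nr : 0 < (n%:R : R) by rewrite ltr0n.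
have nd : 5 / n%:R <= d.
  rewrite ler_pdivrMr// mulrC -ler_pdivrMr//; apply/ltW.
  exact: truncnS_gt.
have [C [covC C0 _ dC]] := sphere2_cover n0.
have diam k : (ediam (C k) <= (5 / n%:R)%:E)%E.
  by apply: ediam_le; [rewrite divr_ge0|exact: dC].
apply: le_trans (_ : (\sum_(k <oo) (pi / 4)%:E * ediam (C k) ^+ 2 <= _)%E).
  apply: ereal_inf_lbound; exists C => //; split => // k.
  by apply: le_trans (diam k) _; rewrite lee_fin.
rewrite (nneseries_split 0%N (54 * n ^ 2)%N); last by move=> *; exact: gauge_ge0.
rewrite add0n [X in (_ + X)%E]eseries0 ?adde0; last first.
  by move=> k hk _; rewrite C0// gauge_set0.
apply: le_trans (_ : (\sum_(0 <= k < 54 * n ^ 2) (pi / 4 * (5 / n%:R) ^+ 2)%:E <= _)%E).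
  apply: lee_sum => k _; rewrite [leRHS]EFinM lee_wpmul2l ?lee_fin ?divr_ge0 ?pi_ge0//.
  by rewrite EFin_expe !expe2; apply: lee_pmul; rewrite ?ediam_ge0.
rewrite sumEFin sumr_const_nat subn0 lee_fin -[leLHS]mulr_natr natrM natrX.
rewrite [leLHS](_ : _ = 54 * 25 * pi / 4); last first.
  rewrite exprMn exprVn; set x : R := n%:R ^+ 2.
  have x0 : x != 0 by rewrite expf_neq0// gt_eqF.
  by rewrite (_ : 5 ^+ 2 = 25 :> R)//; [rewrite -[RHS]mulr1 -(mulVf x0)|]; lra.
by have := pi_ge0 R; lra.
Qed.

End cover.

(** * Measurability of quadratic forms and orthogonal invariance *)

Section measurability.
Context {R : realType}.
Local Notation cT := (caratheodory_type (hausdorff2_outer R)).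
Implicit Types (p q : 'cV[R]_3) (B M : 'M[R]_3).

Lemma enormB_coord p q i : `|p i 0 - q i 0| <= enorm (p - q).
Proof. by have := normr_coord_le (p - q) i; rewrite !mxE. Qed.

(** Coordinates are 1-Lipschitz, so the layer argument applies to their sublevel sets. The
    measurability of quadratic forms, hence of all weights, rests on this. *)
Lemma measurable_coord i : measurable_fun [set: cT] (fun p : cT => (p : 'cV[R]_3) i 0).
Proof.
apply: (measurability _ (RGenOInfty.measurableE R)) => _ [_ [x ->] <-].
rewrite setTI (_ : _ @^-1` _ = ~` [set p : cT | (p : 'cV[R]_3) i 0 <= x]); last first.
  by apply/seteqP; split => p /=; rewrite in_itv/= andbT ltNge => /negP.
apply: measurableC.
exact: (@hausdorff2_sublevel _ (fun p : 'cV[R]_3 => p i 0) x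
  (fun p q => enormB_coord p q i)).
Qed.

Definition qf B p : R := dot (B *m p) p.

Lemma qfE B p : qf B p = \sum_i \sum_j B i j * (p i 0 * p j 0).
Proof.
rewrite /qf /dot mxE; apply: eq_bigr => i _; rewrite !mxE big_distrl/=.
by apply: eq_bigr => j _; rewrite mulrAC mulrA.
Qed.

Lemma measurable_qf B : measurable_fun [set: cT] (fun p : cT => qf B p).
Proof.
under eq_fun do rewrite qfE.
apply: measurable_sum => i; apply: measurable_sum => j.
apply: measurable_funM; first exact: measurable_cst.
by apply: measurable_funM; exact: measurable_coord.
Qed.

Lemma measurable_dot q : measurable_fun [set: cT] (fun p : cT => dot p q).
Proof.
under eq_fun do rewrite dotE.
have h i : measurable_fun [set: cT] (fun p : cT => (p : 'cV[R]_3) i 0 * q i 0).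
  by apply: measurable_funM; [exact: measurable_coord|exact: measurable_cst].
by apply: measurable_funD; [apply: measurable_funD|]; exact: h.
Qed.

Lemma qf1 p : qf 1%:M p = dot p p. Proof. by rewrite /qf mul1mx. Qed.

Lemma measurable_eq_cst (g : cT -> R) c : measurable_fun setT g ->
  measurable [set p | g p = c].
Proof.
move=> mg; have -> : [set p | g p = c] = setT `&` g @^-1` [set c] by rewrite setTI.
exact: mg.
Qed.

Lemma measurable_sphere : measurable (@sphere2 R : set cT).
Proof.
have -> : @sphere2 R = [set p | qf 1%:M p = 1].
  by apply/seteqP; split => p /=; rewrite qf1 => /sphere2P.
exact/measurable_eq_cst/measurable_qf.
Qed.

Definition quadric B : set 'cV[R]_3 := [set p | sphere2 p /\ qf B p = 0].

Lemma measurable_quadric B : measurable (quadric B : set cT).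
Proof.
apply: measurableI; first exact: measurable_sphere.
exact/measurable_eq_cst/measurable_qf.
Qed.

Lemma hausdorff2_orthogonal M (A : set 'cV[R]_3) : M^T *m M = 1%:M ->
  hausdorff2 (mulmx M @^-1` A) = hausdorff2 A.
Proof.
move=> MM; apply: (@hausdorff2_isometry _ _ (mulmx M^T)).
  by move=> p; rewrite mulmxA (mulmx1C MM) mul1mx.
move=> p q; rewrite -mulmxBr /enorm /dot trmx_mul -mulmxA (mulmxA M^T) MM.
by rewrite mul1mx.
Qed.

Lemma qf_mul B M p : qf B (M *m p) = qf (M^T *m B *m M) p.
Proof.
by rewrite /qf /dot !trmx_mul trmxK -!mulmxA.
Qed.

End measurability.

(** * Quadrics are null sets of the sphere *)

Section quadric_null.
Context {R : realType}.
Local Notation cT := (caratheodory_type (hausdorff2_outer R)).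
Implicit Types (p q : 'cV[R]_3) (B M : 'M[R]_3) (s : R).

(** Induction on the degree: an integer root m is split off, and the integers beyond m are not roots
    of its linear factor. *)
Lemma poly_eventually_neq0 (P : {poly R}) : P != 0 ->
  exists N, forall m, (N <= m)%N -> P.[m%:R] != 0.
Proof.
have [n] := ubnP (size P); elim: n P => // n ih P; rewrite ltnS => szP P0.
have [h|/existsNP[m /negP]] := pselect (forall m, P.[m%:R] != 0); first by exists 0%N.
rewrite negbK => /factor_theorem [Q PQ].
have Q0 : Q != 0 by apply: contra_neq P0 => Q0; rewrite PQ Q0 mul0r.
have szQ : (size Q < n)%N.
  by apply: leq_trans szP; rewrite PQ size_Mmonic ?monicXsubC// size_XsubC addn2.
have [N hN] := ih _ szQ Q0; exists (maxn N m.+1) => k.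
rewrite geq_max => /andP[/hN Qk mk].
rewrite PQ hornerM hornerXsubC mulf_neq0// subr_eq0.
by rewrite eqr_nat gtn_eqF.
Qed.

(** Continuity from above, available because the sphere has finite measure. It serves as a
    pigeonhole principle: a limit superior of positive measure contains a point of infinitely many
    rotated quadrics. *)
Lemma limsup_measure_ge (F : nat -> set cT) (a : \bar R) :
  (forall n, measurable (F n)) -> (forall n, F n `<=` @sphere2 R) ->
  (forall n, (a <= dS R (F n))%E) -> (a <= dS R (lim_sup_set F))%E.
Proof.
move=> mF FS aF.
have FSoo : (dS R (\bigcup_(k >= 0) F k) < +oo)%E.
  apply: le_lt_trans (hausdorff2_sphere_lty (R := R)).
  by apply: le_hausdorff2 => p [n _ /FS].
have cv := lim_sup_set_cvg (dS R) F mF FSoo.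
have <- := cvg_lim _ cv => //.
apply: lime_ge; first by apply/cvg_ex; eexists; exact: cv.
apply: nearW => n; apply: le_trans (aF n) _.
by apply: le_hausdorff2 => p Fp; exists n => //=.
Qed.

(* Rotation around the axis nxt (nxt i), rationally parametrised by the tangent
   of the half-angle. *)
Definition rot (i : 'I_3) s : 'M[R]_3 := \matrix_(k, l)
  (if k == i then if l == i then (1 - s ^+ 2) / (1 + s ^+ 2)
                  else if l == nxt i then - (2 * s) / (1 + s ^+ 2) else 0
   else if k == nxt i then if l == i then 2 * s / (1 + s ^+ 2)
                  else if l == nxt i then (1 - s ^+ 2) / (1 + s ^+ 2) else 0
   else (l == k)%:R).

Lemma rot_orthogonal i s : (rot i s)^T *m rot i s = 1%:M.
Proof.
have s0 : 1 + s ^+ 2 != 0 by rewrite gt_eqF// ltr_pwDl ?sqr_ge0.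
have h : ((1 - s ^+ 2) / (1 + s ^+ 2)) ^+ 2 + (2 * s / (1 + s ^+ 2)) ^+ 2 = 1.
  by rewrite !exprMn -mulrDl exprVn -[RHS](@divff _ ((1 + s ^+ 2) ^+ 2)) ?expf_neq0//;
    congr (_ / _); lra.
apply/matrixP => a b; rewrite mxE sum_I3 !mxE mulNr.
move: ((1 - s ^+ 2) / (1 + s ^+ 2)) (2 * s / (1 + s ^+ 2)) h => c t h.
by elim/I3_ind: i; elim/I3_ind: a; elim/I3_ind: b => /=; lra.
Qed.

Lemma qf_nxt B p i : B^T = B -> let j := nxt i in let k := nxt (nxt i) in
  qf B p = B i i * p i 0 ^+ 2 + B j j * p j 0 ^+ 2 + B k k * p k 0 ^+ 2 +
    2 * (B i j * p i 0 * p j 0 + B i k * p i 0 * p k 0 + B j k * p j 0 * p k 0).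
Proof.
move=> Bs /=; rewrite qfE !sum_I3.
have e a b : B a b = B b a by rewrite -{1}Bs mxE.
rewrite (e i1 i0) (e i2 i0) (e i2 i1).
by elim/I3_ind: i => /=; rewrite ?(e i1 i0) ?(e i2 i0) ?(e i2 i1); lra.
Qed.

Lemma rot_coord i s p : let j := nxt i in let k := nxt (nxt i) in
  [/\ (rot i s *m p) i 0 = ((1 - s ^+ 2) * p i 0 - 2 * s * p j 0) / (1 + s ^+ 2),
      (rot i s *m p) j 0 = (2 * s * p i 0 + (1 - s ^+ 2) * p j 0) / (1 + s ^+ 2)
    & (rot i s *m p) k 0 = p k 0].
Proof.
by elim/I3_ind: i => /=; split; rewrite mxE sum_I3 !mxE/=; lra.
Qed.

(** Multiplied by (1 + s^2)^2, the form at the rotated point is a polynomial of degree at most 4 in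
    s. Infinitely many integer zeros make it vanish identically, so the quadric contains the whole
    circle through p. *)
Lemma circle_quadric B p i : B^T = B -> let j := nxt i in
  p i 0 ^+ 2 + p j 0 ^+ 2 != 0 ->
  (forall N, exists2 n, (N <= n)%N & qf B (rot i n%:R *m p) = 0) ->
  B i j = 0 /\ B i i = B j j.
Proof.
move=> Bs j xy0 inf; set k := nxt j.
set x := p i 0 in xy0 *; set y := p j 0 in xy0 *; pose z := p k 0.
pose X : {poly R} := (1 - 'X^2) * x%:P - 2%:P * 'X * y%:P.
pose Y : {poly R} := 2%:P * 'X * x%:P + (1 - 'X^2) * y%:P.
pose Z : {poly R} := (1 + 'X^2) * z%:P.
pose P : {poly R} := (B i i)%:P * X ^+ 2 + (B j j)%:P * Y ^+ 2 + (B k k)%:P * Z ^+ 2 +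
  2%:P * ((B i j)%:P * X * Y + (B i k)%:P * X * Z + (B j k)%:P * Y * Z).
have PE s : P.[s] = (1 + s ^+ 2) ^+ 2 * qf B (rot i s *m p).
  have s0 : 1 + s ^+ 2 != 0 by rewrite gt_eqF// ltr_pwDl ?sqr_ge0.
  rewrite (@qf_nxt _ _ i)//; have [-> -> ->] := rot_coord i s p.
  rewrite -/j -/k -/x -/y -/z !(hornerD, hornerM, hornerC, hornerX, horner_exp, hornerN).
  set u := 1 + s ^+ 2 in s0 *; set v := 1 - s ^+ 2.
  set X' := v * x - 2 * s * y; set Y' := 2 * s * x + v * y.
  have hu w : u * (w / u) = w by rewrite mulrC divfK.
  have X2 : u ^+ 2 * (X' / u) ^+ 2 = X' ^+ 2 by rewrite -exprMn hu.
  have Y2 : u ^+ 2 * (Y' / u) ^+ 2 = Y' ^+ 2 by rewrite -exprMn hu.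
  have XY : u ^+ 2 * ((X' / u) * (Y' / u)) = X' * Y'.
    by rewrite expr2 mulrACA !hu.
  have XZ : u ^+ 2 * (X' / u * z) = X' * (u * z).
    by rewrite expr2 mulrACA hu.
  have YZ : u ^+ 2 * (Y' / u * z) = Y' * (u * z).
    by rewrite expr2 mulrACA hu.
  transitivity (B i i * (u ^+ 2 * (X' / u) ^+ 2) + B j j * (u ^+ 2 * (Y' / u) ^+ 2)
    + B k k * (u * z) ^+ 2 + 2 * (B i j * (u ^+ 2 * ((X' / u) * (Y' / u))) +
    B i k * (u ^+ 2 * (X' / u * z)) + B j k * (u ^+ 2 * (Y' / u * z)))); last by lra.
  by rewrite X2 Y2 XY XZ YZ; rewrite /X' /Y' /u /v; lra.
have P0 : P = 0.
  apply: contrapT => /eqP /poly_eventually_neq0 [N hN].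
  by have [n /hN + q0] := inf N; rewrite PE q0 mulr0 eqxx.
have ev s : P.[s] = 0 by rewrite P0 horner0.
(* Five values determine a polynomial of degree at most 4. *)
have := ev 0; have := ev 1; have := ev (-1); have := ev 2; have := ev (-2).
rewrite !(hornerD, hornerM, hornerC, hornerX, horner_exp, hornerN).
move: (B i i) (B j j) (B k k) (B i j) (B i k) (B j k) => a b c h g e {P0 ev PE P X Y Z inf}.
move=> e1 e2 e3 e4 e5.
(* [C2] and [S2] say that the second harmonic along the circle vanishes. As a linear system in a - b
   and h they have determinant -(x^2 + y^2)^2. *)
have C2 : (a - b) * (x ^+ 2 - y ^+ 2) + 4 * h * (x * y) = 0 by lra.
have S2 : (a - b) * (x * y) = h * (x ^+ 2 - y ^+ 2) by lra.
have xy2 : (x ^+ 2 + y ^+ 2) ^+ 2 != 0 by rewrite expf_neq0.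
have ab : (a - b) * (x ^+ 2 + y ^+ 2) ^+ 2 = 0.
  rewrite (_ : _ * _ = ((a - b) * (x ^+ 2 - y ^+ 2)) * (x ^+ 2 - y ^+ 2) +
    4 * ((a - b) * (x * y)) * (x * y)); last by lra.
  by rewrite S2 (_ : (a - b) * _ = - (4 * h * (x * y))); lra.
have hh : h * (x ^+ 2 + y ^+ 2) ^+ 2 = 0.
  rewrite (_ : _ * _ = (h * (x ^+ 2 - y ^+ 2)) * (x ^+ 2 - y ^+ 2) +
    (4 * h * (x * y)) * (x * y)); last by lra.
  by rewrite -S2 (_ : 4 * h * _ = - ((a - b) * (x ^+ 2 - y ^+ 2))); lra.
move: ab hh => /eqP; rewrite mulf_eq0 (negbTE xy2) orbF subr_eq0 => /eqP ->.
by move=> /eqP; rewrite mulf_eq0 (negbTE xy2) orbF => /eqP ->.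
Qed.

End quadric_null.

Section quadric_null_sets.
Context {R : realType}.
Local Notation cT := (caratheodory_type (hausdorff2_outer R)).
Implicit Types (p q : 'cV[R]_3) (B M : 'M[R]_3) (s : R).

(** These are the two fixed points of the rotation, whose orbits carry no information. Being null,
    they can be avoided when a point is chosen in infinitely many copies of the quadric. *)
Lemma poles_null i :
  hausdorff2 [set p : 'cV[R]_3 | sphere2 p /\ p i 0 ^+ 2 + p (nxt i) 0 ^+ 2 = 0] = 0%E.
Proof.
pose e s : 'cV[R]_3 := \col_j (if j == nxt (nxt i) then s else 0).
apply/eqP; rewrite eq_le hausdorff2_ge0 andbT.
apply: le_trans (_ : (hausdorff2 ([set e 1%R] `|` [set e (-1)%R]) <= _)%E).
  apply: le_hausdorff2 => p [/sphere2P]; rewrite (dot_nxt p p i) => h xy.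
  have x2 := sqr_ge0 (p i 0); have y2 := sqr_ge0 (p (nxt i) 0).
  have x0 : p i 0 = 0 by apply/eqP; rewrite -sqrf_eq0; apply/eqP; lra.
  have y0 : p (nxt i) 0 = 0 by apply/eqP; rewrite -sqrf_eq0; apply/eqP; lra.
  have pE : p = e (p (nxt (nxt i)) 0).
    apply/matrixP => a b; rewrite ord1 mxE; move: x0 y0 => {h xy x2 y2}.
    by elim/I3_ind: i @e; elim/I3_ind: a.
  have : (p (nxt (nxt i)) 0) ^+ 2 == 1 by apply/eqP; lra.
  by rewrite sqrf_eq1 => /orP[] /eqP z; [left|right] => /=; rewrite pE z.
apply: le_trans (outer_measureU2 (hausdorff2_outer R) _ _) _.
by rewrite /= !hausdorff2_set1 adde0.
Qed.

Lemma quadric_null B : B^T = B -> B != 0 ->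
  hausdorff2 (quadric B) = 0%E.
Proof.
move=> Bs B0; apply/eqP; rewrite eq_le hausdorff2_ge0 andbT leNgt.
apply: contraNN B0 => pos.
have circ i : B i (nxt i) = 0 /\ B i i = B (nxt i) (nxt i).
  pose F n : set cT := [set p : 'cV[R]_3 | sphere2 p /\ qf B (rot i n%:R *m p) = 0].
  have Fmul n : F n = mulmx (rot i n%:R) @^-1` (quadric B).
    have eS p : enorm (rot i n%:R *m p) = enorm p.
      by rewrite /enorm -(qf1 (_ *m p)) qf_mul mulmx1 rot_orthogonal qf1.
    by apply/seteqP; split => p /= [Sp Bp]; split => //; move: Sp;
      rewrite /sphere2/= eS.
  have FE n : dS R (F n) = hausdorff2 (quadric B).
    by rewrite Fmul; apply: hausdorff2_orthogonal; exact: rot_orthogonal.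
  have : (hausdorff2 (quadric B) <= dS R (lim_sup_set F))%E.
    apply: limsup_measure_ge => n; last by rewrite FE.
      rewrite (_ : F n = quadric ((rot i n%:R)^T *m B *m rot i n%:R)).
        exact: measurable_quadric.
      by apply/funext => p; rewrite /F /quadric /mkset qf_mul.
    by move=> p [].
  move=> /(lt_le_trans pos) lpos.
  have [p [Lp xy]] : exists p, lim_sup_set F p /\ p i 0 ^+ 2 + p (nxt i) 0 ^+ 2 != 0.
    apply: contrapT => /forallNP h; move: lpos; rewrite ltNge => /negP; apply.
    rewrite -(poles_null i); apply: le_hausdorff2 => p Lp; split.
      by have [n _ []] := Lp 0%N I.
    by apply/eqP; apply: contrapT => /negP xy; apply: (h p).
  apply: (circle_quadric Bs xy) => N.
  by have [n /= Nn [_ ?]] := Lp N I; exists n.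
have [p [Sp Bp]] : exists p, sphere2 p /\ qf B p = 0.
  apply: contrapT => /forallNP h; move: pos; rewrite ltNge => /negP; apply.
  rewrite (_ : quadric B = set0) ?(outer_measure0 (hausdorff2_outer R))//.
  by apply/seteqP; split => // p /h.
have [h01 d01] := circ i0; have [h12 d12] := circ i1; have [h20 d20] := circ i2.
have e a b : B a b = B b a by rewrite -{1}Bs mxE.
rewrite /= in h01 d01 h12 d12 h20 d20.
(* B is now a scalar matrix, so its form is the constant B00 on the sphere, and it vanishes at the
   point p of the quadric. *)
have B00 : B i0 i0 = 0.
  move: Bp; rewrite (qf_nxt _ i0 Bs)/= h01 h12 (e i0 i2) h20 -d12 -d01.
  by move/sphere2P : Sp; rewrite dotE => Sp h; rewrite -[LHS]mulr1 -Sp; lra.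
apply/eqP/matrixP => a b; rewrite mxE.
by elim/I3_ind: a; elim/I3_ind: b => //; rewrite -?d12 -?d01 ?B00//;
  rewrite e.
Qed.

(** As 1 - p . q = |p - q|^2 / 2, a small cell lies in the cap around any of its points. If all
    these caps were null, countably many cells could not cover a sphere of positive measure. *)
Lemma cap_gt0 s : (0 < hausdorff2 (@sphere2 R))%E -> 0 < s ->
  exists2 q, sphere2 q &
    (0 < hausdorff2 [set p : 'cV[R]_3 | sphere2 p /\ (1 - s <= dot p q)%R])%E.
Proof.
move=> S0 s0; apply: contrapT => /forall2NP h; move: S0; rewrite ltNge => /negP; apply.
pose n := (Num.truncn (25 / s)).+1.
have n0 : (0 < n)%N by [].
have nr : 1 <= (n%:R : R) by rewrite ler1n.
have ns : 25 / n%:R ^+ 2 <= s.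
  rewrite ler_pdivrMr ?exprn_gt0 ?(lt_le_trans _ nr)// mulrC -ler_pdivrMr//.
  apply: le_trans (ltW (truncnS_gt (25 / s))) _.
  by rewrite -/n expr2 ler_peMr// (le_trans _ nr).
have [C [covC _ CS dC]] := @sphere2_cover R n n0.
apply: le_trans (le_hausdorff2 covC) _.
apply: le_trans (outer_measure_sigma_subadditive (hausdorff2_outer R) _) _.
rewrite eseries0// => k _ _; apply/eqP; rewrite eq_le hausdorff2_ge0 andbT.
have [[q Cq]|C0] := pselect (C k !=set0); last first.
  have -> : C k = set0 by apply/seteqP; split => // q ?; apply: C0; exists q.
  by rewrite (outer_measure0 (hausdorff2_outer R)).
case: (h q) => [/(_ (CS _ _ Cq))//|/negP]; rewrite -leNgt; apply: le_trans.
apply: le_hausdorff2 => p Cp; split; first exact: CS Cp.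
have := dC _ _ _ Cp Cq; have := CS _ _ Cp; have := CS _ _ Cq.
move=> /sphere2P qq /sphere2P pp.
have d0 : 0 <= dot (p - q) (p - q) by rewrite dotE -!expr2 !addr_ge0 ?sqr_ge0.
have nn : 0 <= 5 / n%:R :> R by rewrite divr_ge0.
move=> pq; have : enorm (p - q) ^+ 2 <= (5 / n%:R) ^+ 2.
  by rewrite ler_sqr ?nnegrE ?sqrtr_ge0.
rewrite /enorm sqr_sqrtr// exprMn exprVn (_ : 5 ^+ 2 = 25 :> R); last lra.
move: pp qq; rewrite !dotE !mxE; lra.
Qed.

End quadric_null_sets.

(** * Integration on the sphere *)

Section sphere_integral.
Context {R : realType}.
Local Notation cT := (caratheodory_type (hausdorff2_outer R)).
Local Notation S := (@sphere2 R).
Local Notation mu := (dS R).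
Implicit Types (f g h : 'cV[R]_3 -> R) (p q : 'cV[R]_3) (B L Q H : 'M[R]_3).

(* Locked, because comparing two integrals by unfolding them diverges; for the
   same reason the partition function Zpart below is locked. *)
Definition sint : ('cV[R]_3 -> R) -> R :=
  locked (fun g => \int[dS R]_(p in @sphere2 R) g p).
Definition L1 g : Prop := (dS R).-integrable (@sphere2 R) (EFin \o g).
Definition aeS (P : 'cV[R]_3 -> Prop) : Prop := {ae dS R, forall p, sphere2 p -> P p}.
(** This class is stable under the operations that build Gibbs densities, is integrable because the
    sphere has finite area, and multiplies [L1] into itself. *)
Definition bm g : Prop := measurable_fun (S : set cT) (g : cT -> R) /\
  exists C, forall p, S p -> `|g p| <= C.

Let mS : measurable (S : set cT) := measurable_sphere (R := R).

Let aeF : Filter (nbhs (almost_everywhere (dS R))).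
Proof. by typeclasses eauto. Qed.

Lemma sintE g : sint g = \int[dS R]_(p in @sphere2 R) g p.
Proof. by rewrite /sint; unlock. Qed.

Lemma aeS_imp (P P' : 'cV[R]_3 -> Prop) :
  aeS P -> (forall p, sphere2 p -> P p -> P' p) -> aeS P'.
Proof. by rewrite /aeS => + i; apply: (@filterS _ _ aeF) => p hp Sp; exact/i/hp. Qed.

Lemma aeS_imp2 (P P' P'' : 'cV[R]_3 -> Prop) :
  aeS P -> aeS P' -> (forall p, sphere2 p -> P p -> P' p -> P'' p) -> aeS P''.
Proof.
by rewrite /aeS => + + i; apply: (@filterS2 _ _ aeF) => p hp hp' Sp; apply: i => //;
  [exact: hp|exact: hp'].
Qed.

Lemma aeS_all (P : 'cV[R]_3 -> Prop) : (forall p, sphere2 p -> P p) -> aeS P.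
Proof. by move=> h; apply: aeW => p Sp; exact: h. Qed.

Lemma bm_cst c : bm (fun=> c).
Proof. by split; [exact: measurable_cst|exists `|c|]. Qed.

Lemma bmD f g : bm f -> bm g -> bm (fun p => f p + g p).
Proof.
move=> [mf [C hC]] [mg [D hD]]; split; first exact: measurable_funD.
exists (C + D) => p Sp; apply: le_trans (ler_normD _ _) _.
by apply: lerD; [exact: hC|exact: hD].
Qed.

Lemma bmM f g : bm f -> bm g -> bm (fun p => f p * g p).
Proof.
move=> [mf [C hC]] [mg [D hD]]; split; first exact: measurable_funM.
exists (C * D) => p Sp; rewrite normrM.
by apply: ler_pM => //; [exact: hC|exact: hD].
Qed.

Lemma bmN f : bm f -> bm (fun p => - f p).
Proof.
move=> bf; have := bmM (bm_cst (-1)) bf.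
by under [X in bm X -> _]eq_fun do rewrite mulN1r.
Qed.

Lemma bmB f g : bm f -> bm g -> bm (fun p => f p - g p).
Proof. by move=> bf bg; exact/bmD/bmN. Qed.

Lemma bm_max0 f : bm f -> bm (fun p => Num.max (f p) 0).
Proof.
move=> [mf [C hC]]; split; first by apply: measurable_maxr => //; exact: measurable_cst.
exists C => p Sp; apply: le_trans (hC p Sp).
by rewrite ger0_norm ?le_max ?lexx ?orbT// ge_max ler_norm normr_ge0.
Qed.

Lemma bm_expR f : bm f -> bm (fun p => expR (f p)).
Proof.
move=> [mf [C hC]]; split; first by apply: measurableT_comp => //; exact: measurable_expR.
exists (expR C) => p Sp; rewrite ger0_norm ?expR_ge0// ler_expR.
exact: le_trans (ler_norm _) (hC p Sp).
Qed.

Lemma bm_pos f : bm f -> bm (fun p => (0 < f p)%R%:R).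
Proof.
move=> [mf _]; split; last first.
  by exists 1 => p _; case: (0 < f p); rewrite ?normr1 ?normr0 ?ler01.
rewrite (_ : (fun p => _) = (fun p => if 0 < f p then 1 else 0)); last first.
  by apply/funext => p; case: (0 < f p).
apply: (@measurable_fun_if _ _ cT R _ _ S mS (fun p => 0 < f p)).
- by apply: measurable_fun_ltr; [exact: measurable_cst|exact: mf].
- exact: measurable_cst.
- exact: measurable_cst.
Qed.

(** [|B|] is the sup norm, so 9 counts the entries. The constants 18, 81 and 162 further on come
    from this 9. *)
Lemma normr_qf_le B p : sphere2 p -> `|qf B p| <= 9 * `|B|.
Proof.
move=> Sp; have e i j : `|B i j * (p i 0 * p j 0)| <= `|B|.
  rewrite normrM -[leRHS]mulr1 normrM; apply: ler_pM => //.
    by rewrite [leRHS]mx_normrE; apply: (le_bigmax _ (fun ij => `|B ij.1 ij.2|) (i, j)).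
  by rewrite -[leRHS]mulr1; apply: ler_pM => //; exact: sphere2_coord_le1.
rewrite qfE; apply: le_trans (ler_norm_sum _ _ _) _.
apply: (@le_trans _ _ (\sum_(i < 3) (3 * `|B|))).
  apply: ler_sum => i _; apply: le_trans (ler_norm_sum _ _ _) _.
  apply: (@le_trans _ _ (\sum_(j < 3) `|B|)); first by apply: ler_sum => j _; exact: e.
  by rewrite sumr_const card_ord; lra.
by rewrite sumr_const card_ord; lra.
Qed.

Lemma bm_qf B : bm (qf B).
Proof.
split; first exact/measurable_funTS/measurable_qf.
by exists (9 * `|B|) => p; exact: normr_qf_le.
Qed.

Lemma bm_integrable f : bm f -> L1 f.
Proof.
move=> [mf [C hC]]; apply: measurable_bounded_integrable => //.
  exact: hausdorff2_sphere_lty.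
exists C; split; first exact: num_real.
by move=> M CM p Sp; apply: le_trans (hC p Sp) (ltW CM).
Qed.

Lemma L1_measurable f : L1 f -> measurable_fun (S : set cT) (f : cT -> R).
Proof. by move=> /integrableP[mf _]; exact/measurable_EFinP. Qed.

Lemma L1M f g : L1 f -> bm g -> L1 (fun p => f p * g p).
Proof.
move=> Lf [mg [C hC]].
have := @integrableMl _ _ _ mu _ mS _ g Lf mg.
rewrite /L1 (_ : (EFin \o f) \* (EFin \o g) = EFin \o (fun p => (f p * g p)%R))%E.
  apply; exists C; split; first exact: num_real.
  by move=> M CM p Sp; apply: le_trans (hC p Sp) (ltW CM).
by apply/funext => p.
Qed.

Lemma L1D f g : L1 f -> L1 g -> L1 (fun p => f p + g p).
Proof. by move=> Lf Lg; exact: (integrableD mS Lf Lg). Qed.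

Lemma L1B f g : L1 f -> L1 g -> L1 (fun p => f p - g p).
Proof. by move=> Lf Lg; exact: (integrableB mS Lf Lg). Qed.

Lemma L1Z c f : L1 f -> L1 (fun p => c * f p).
Proof. by move=> Lf; exact: (integrableZl mS c Lf). Qed.

Lemma eq_sint f g : (forall p, S p -> f p = g p) -> sint f = sint g.
Proof. by move=> fg; rewrite !sintE; apply: eq_Rintegral => p /set_mem; exact: fg. Qed.

Lemma sintD f g : L1 f -> L1 g -> sint (fun p => f p + g p) = sint f + sint g.
Proof. by move=> Lf Lg; rewrite !sintE; exact: RintegralD. Qed.

Lemma sintB f g : L1 f -> L1 g -> sint (fun p => f p - g p) = sint f - sint g.
Proof. by move=> Lf Lg; rewrite !sintE; exact: RintegralB. Qed.

Lemma sintZ c f : L1 f -> sint (fun p => c * f p) = c * sint f.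
Proof. by move=> Lf; rewrite !sintE; exact: RintegralZl. Qed.

Lemma sint0 : sint (fun=> 0) = 0.
Proof. by rewrite sintE Rintegral_cst// mul0r. Qed.

Lemma sintN f : L1 f -> sint (fun p => - f p) = - sint f.
Proof.
by move=> Lf; rewrite -mulN1r -sintZ//; apply: eq_sint => p _; rewrite mulN1r.
Qed.

Lemma le_sint f g : L1 f -> L1 g -> (forall p, S p -> f p <= g p) -> sint f <= sint g.
Proof. by move=> Lf Lg fg; rewrite !sintE; apply: le_Rintegral. Qed.

Lemma sint_ge0 f : (forall p, S p -> 0 <= f p) -> 0 <= sint f.
Proof. by move=> f0; rewrite !sintE; apply: Rintegral_ge0. Qed.

Lemma L1_sum (I : Type) (r : seq I) (F : I -> 'cV[R]_3 -> R) :
  (forall i, L1 (F i)) -> L1 (fun p => \sum_(i <- r) F i p).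
Proof.
move=> LF; elim: r => [|i r ih].
  under eq_fun do rewrite big_nil.
  exact/bm_integrable/bm_cst.
under eq_fun do rewrite big_cons.
exact: L1D.
Qed.

Lemma sint_sum (I : Type) (r : seq I) (F : I -> 'cV[R]_3 -> R) :
  (forall i, L1 (F i)) ->
  sint (fun p => \sum_(i <- r) F i p) = \sum_(i <- r) sint (F i).
Proof.
move=> LF; elim: r => [|i r ih].
  by rewrite big_nil -[RHS]sint0; apply: eq_sint => p _; rewrite big_nil.
rewrite big_cons -ih -sintD//; last exact: L1_sum.
by apply: eq_sint => p _; rewrite big_cons.
Qed.

Lemma ae_eq_sint f g : L1 f -> L1 g -> aeS (fun p => f p = g p) -> sint f = sint g.
Proof.
move=> Lf Lg fg; rewrite !sintE; congr fine.
apply: (ae_eq_integral _ _ mS (measurable_int mu Lf) (measurable_int mu Lg)).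
by move: fg; rewrite /aeS; apply: (@filterS _ _ aeF) => p h Sp /=; rewrite h.
Qed.

(** The Caratheodory measure is complete, which makes g measurable. *)
Lemma ae_eq_L1 f g : L1 f -> aeS (fun p => f p = g p) -> L1 g.
Proof.
move=> Lf fg; have /integrableP[mf foo] := Lf.
have fgE : ae_eq mu S (EFin \o f) (EFin \o g).
  by move: fg; rewrite /aeS; apply: (@filterS _ _ aeF) => p h Sp /=; rewrite h.
have mg : measurable_fun (S : set cT) (EFin \o g).
  apply: (ae_measurable_fun _ fgE mf).
  exact: measure_is_complete_caratheodory.
apply/integrableP; split; first exact: mg.
have fgN : ae_eq mu S (abse \o (EFin \o f)) (abse \o (EFin \o g)).
  by move: fg; rewrite /aeS; apply: (@filterS _ _ aeF) => p h Sp /=; rewrite h.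
have mfN : measurable_fun (S : set cT) (abse \o (EFin \o f)).
  by apply: measurableT_comp; [exact: abse_measurable|exact: mf].
have mgN : measurable_fun (S : set cT) (abse \o (EFin \o g)).
  by apply: measurableT_comp; [exact: abse_measurable|exact: mg].
by rewrite -(ae_eq_integral _ _ mS mfN mgN fgN).
Qed.

Lemma L1_norm f : L1 f -> L1 (fun p => `|f p|).
Proof. by move=> Lf; exact: (integrable_abse Lf). Qed.

Lemma sint_le0_ae f : L1 f -> aeS (fun p => 0 <= f p) -> sint f <= 0 ->
  aeS (fun p => f p = 0).
Proof.
move=> Lf f0 sf; have Ln := L1_norm Lf.
have sfn : sint (fun p => `|f p|) = sint f.
  by apply: (ae_eq_sint Ln Lf); apply: (aeS_imp f0) => p _ /ger0_norm.
have s0 : sint (fun p => `|f p|) = 0.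
  by apply/eqP; rewrite eq_le {1}sfn sf/= sint_ge0.
have : (\int[mu]_(p in S) `|(EFin \o f) p| = 0)%E.
  by have := congr1 EFin s0; rewrite sintE /Rintegral (fineK (integrable_fin_num mS Ln)).
move=> h0; have := (ae_eq_integral_abs mu mS (measurable_int mu Lf)).1 h0.
by apply: (@filterS _ _ aeF) => p h Sp; have := h Sp; case.
Qed.

Lemma quadric_ae B : B^T = B -> B != 0 -> aeS (fun p => qf B p != 0).
Proof.
move=> Bs B0; exists (quadric B); split.
- exact: measurable_quadric.
- exact: quadric_null.
- move=> p /= /not_implyP [Sp /negP]; rewrite negbK => /eqP h.
  by split.
Qed.

End sphere_integral.

(** * Moments, Gibbs densities and energy *)

Section quadratic_forms.
Context {R : realType}.
Implicit Types (f g h : 'cV[R]_3 -> R) (p q : 'cV[R]_3) (A B L Q H : 'M[R]_3).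

Lemma qfD A B p : qf (A + B) p = qf A p + qf B p.
Proof. by rewrite /qf /dot mulmxDl linearD mulmxDl mxE. Qed.

Lemma qfZ a B p : qf (a *: B) p = a * qf B p.
Proof. by rewrite /qf /dot -scalemxAl linearZ -scalemxAl mxE. Qed.

Lemma qfB A B p : qf (A - B) p = qf A p - qf B p.
Proof. by rewrite qfD -scaleN1r qfZ mulN1r. Qed.

Lemma qf_scalar a p : sphere2 p -> qf a%:M p = a.
Proof. by move=> /sphere2P pp; rewrite -scalemx1 qfZ qf1 pp mulr1. Qed.

Lemma frobE A B : frob A B = \sum_i \sum_j A i j * B j i.
Proof. by rewrite /frob /mxtrace; apply: eq_bigr => i _; rewrite mxE. Qed.

Lemma frobDr A B L : frob A (B + L) = frob A B + frob A L.
Proof. by rewrite /frob mulmxDr mxtraceD. Qed.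

Lemma frobZr a A B : frob A (a *: B) = a * frob A B.
Proof. by rewrite /frob -scalemxAr mxtraceZ. Qed.

Lemma frobBr A B L : frob A (B - L) = frob A B - frob A L.
Proof. by rewrite frobDr -scaleN1r frobZr mulN1r. Qed.

Lemma frobC A B : frob A B = frob B A.
Proof. exact: mxtrace_mulC. Qed.

Lemma sym0D A B : sym0 A -> sym0 B -> sym0 (A + B).
Proof.
by move=> [As At] [Bs Bt]; split; rewrite ?linearD/= ?As ?Bs ?mxtraceD ?At ?Bt ?addr0.
Qed.

Lemma sym0Z a A : sym0 A -> sym0 (a *: A).
Proof. by move=> [As At]; split; rewrite ?linearZ/= ?As ?mxtraceZ ?At ?mulr0. Qed.

Lemma sym0B A B : sym0 A -> sym0 B -> sym0 (A - B).
Proof. by move=> sA sB; rewrite -scaleN1r; apply: sym0D => //; exact: sym0Z. Qed.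

Lemma sym0_0 : sym0 (0 : 'M[R]_3).
Proof. by split; rewrite ?linear0. Qed.

Lemma frob_eq0 A : A^T = A -> frob A A = 0 -> A = 0.
Proof.
move=> As; rewrite frobE => h.
have hE : \sum_i \sum_j (A i j) ^+ 2 = 0.
  rewrite -[RHS]h; apply: eq_bigr => i _; apply: eq_bigr => j _.
  by rewrite -{3}As mxE expr2.
apply/matrixP => i j; rewrite mxE; apply/eqP; rewrite -sqrf_eq0.
move/eqP : hE; rewrite psumr_eq0; last by move=> k _; apply: sumr_ge0 => *; exact: sqr_ge0.
move=> /allP/(_ i); rewrite mem_index_enum => /(_ isT)/=.
rewrite psumr_eq0; last by move=> k _; exact: sqr_ge0.
by move=> /allP/(_ j); rewrite mem_index_enum => /(_ isT).
Qed.

Lemma sym0_frob_inj A B : sym0 A -> sym0 B ->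
  (forall H, sym0 H -> frob A H = frob B H) -> A = B.
Proof.
move=> sA sB h; apply/eqP; rewrite -subr_eq0; apply/eqP.
have sAB := sym0B sA sB.
apply: frob_eq0; first exact: sAB.1.
by rewrite frobBr ![frob (A - B) _]frobC (h _ sAB) subrr.
Qed.

Lemma normr_frob_le A B : `|frob A B| <= 9 * `|A| * `|B|.
Proof.
have le M i j : `|(M : 'M[R]_3) i j| <= `|M|.
  by rewrite [leRHS]mx_normrE; apply: (le_bigmax _ (fun ij => `|M ij.1 ij.2|) (i, j)).
rewrite frobE; apply: le_trans (ler_norm_sum _ _ _) _.
apply: (@le_trans _ _ (\sum_(i < 3) (3 * (`|A| * `|B|)))).
  apply: ler_sum => i _; apply: le_trans (ler_norm_sum _ _ _) _.
  apply: (@le_trans _ _ (\sum_(j < 3) (`|A| * `|B|))).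
    by apply: ler_sum => j _; rewrite normrM; apply: ler_pM.
  by rewrite sumr_const card_ord; lra.
by rewrite sumr_const card_ord; lra.
Qed.

Lemma tlessE p i j : tless p i j = p i 0 * p j 0 - (i == j)%:R / 3.
Proof.
rewrite /tless !mxE big_ord1 !mxE; case: eqP => _; first by rewrite mulr1n !mul1r.
by rewrite mulr0n mul0r.
Qed.

Lemma bm_coord i : bm (fun p : 'cV[R]_3 => p i 0).
Proof.
split; first exact/measurable_funTS/measurable_coord.
by exists 1 => p; exact: sphere2_coord_le1.
Qed.

Lemma bm_tless i j : bm (fun p : 'cV[R]_3 => tless p i j).
Proof.
under eq_fun do rewrite tlessE.
by apply: bmB; [apply: bmM; exact: bm_coord|exact: bm_cst].
Qed.

Lemma momentE f i j : moment f i j = sint (fun p => f p * tless p i j).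
Proof. by rewrite mxE sintE. Qed.

Lemma sum_moment f (c : 'I_3 -> 'I_3 -> R) : L1 f ->
  \sum_i \sum_j moment f i j * c i j =
  sint (fun p => f p * \sum_i \sum_j tless p i j * c i j).
Proof.
move=> Lf.
have Lij i j : L1 (fun p => c i j * (f p * tless p i j)).
  by apply: L1Z; apply: (L1M Lf); exact: bm_tless.
transitivity (\sum_i \sum_j sint (fun p => c i j * (f p * tless p i j))).
  apply: eq_bigr => i _; apply: eq_bigr => j _; rewrite momentE mulrC sintZ//.
  by apply: (L1M Lf); exact: bm_tless.
under eq_bigr do rewrite -sint_sum//.
rewrite -sint_sum; last by move=> i; exact: L1_sum.
apply: eq_sint => p _; rewrite big_distrr/=; apply: eq_bigr => i _.
by rewrite big_distrr/=; apply: eq_bigr => j _; rewrite [RHS]mulrA mulrC.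
Qed.

(** The part I / 3 of [tless] pairs with L to a multiple of its trace, which is 0. *)
Lemma frob_moment f L : L1 f -> \tr L = 0 ->
  frob (moment f) L = sint (fun p => f p * qf L p).
Proof.
move=> Lf trL; rewrite frobE sum_moment//; apply: eq_sint => p _.
congr (_ * _); rewrite qfE; move: trL; rewrite /mxtrace !sum_I3 !tlessE/= => trL.
by rewrite -[RHS]subr0 -(mul0r (1/3)) -{1}trL; lra.
Qed.

Lemma sym0_moment f : L1 f -> sym0 (moment f).
Proof.
move=> Lf; split.
  apply/matrixP => i j; rewrite mxE !momentE; apply: eq_sint => p _.
  by rewrite !tlessE eq_sym (mulrC (p j 0)).
rewrite /mxtrace; under eq_bigr do rewrite momentE.
rewrite -sint_sum; last by move=> i; apply: (L1M Lf); exact: bm_tless.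
rewrite -[RHS]sint0; apply: eq_sint => p /sphere2P; rewrite dotE => pp.
rewrite sum_I3 !tlessE/= -!mulrDr.
by rewrite [X in _ * X](_ : _ = 0) ?mulr0//; lra.
Qed.

(** For a unit vector p, (p . q)^2 - 1/3 is the quadratic form of [tless q] at p. Hence the
    interaction sees f through its moment alone. *)
Lemma inner_moment f p : L1 f -> sphere2 p ->
  sint (fun q => (dot p q ^+ 2 - 1 / 3) * f q) = qf (moment f) p.
Proof.
move=> Lf Sp; rewrite qfE sum_moment//; apply: eq_sint => q _.
rewrite mulrC; congr (_ * _); move: Sp => /sphere2P; rewrite !dotE => Sp.
by rewrite !sum_I3 !tlessE/=; lra.
Qed.

End quadratic_forms.

Section energy.
Context {R : realType}.
Local Notation cT := (caratheodory_type (hausdorff2_outer R)).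
Local Notation S := (@sphere2 R).
Local Notation mu := (dS R).
Implicit Types (f g h : 'cV[R]_3 -> R) (p q : 'cV[R]_3) (A B L Q H : 'M[R]_3) (eta : R).

Let mS : measurable (S : set cT) := measurable_sphere (R := R).

Let aeF : Filter (nbhs (almost_everywhere (dS R))).
Proof. by typeclasses eauto. Qed.

Lemma energyE eta f : L1 f -> energy eta f = (\int[mu]_(p in S)
  ((f p * ln (f p))%:E - (f p)%:E * lne (qf (moment f) p - eta)%:E))%E.
Proof.
move=> Lf; apply: eq_integral => p /set_mem Sp.
by rewrite -(inner_moment Lf Sp) sintE.
Qed.

Lemma integral_sint g : L1 g -> (\int[mu]_(p in S) (g p)%:E)%E = (sint g)%:E.
Proof. by move=> Lg; rewrite sintE /Rintegral (fineK (integrable_fin_num mS Lg)). Qed.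

Definition Zpart : R -> 'M[R]_3 -> 'M[R]_3 -> R :=
  locked (fun eta Q L => sint (fun p => expR (qf L p) * weight eta Q p)).

Lemma ZpartE eta Q L :
  Zpart eta Q L = sint (fun p => expR (qf L p) * weight eta Q p).
Proof. by rewrite /Zpart; unlock. Qed.

Definition gibbs eta Q L p : R :=
  (Zpart eta Q L)^-1 * expR (qf L p) * weight eta Q p.

Lemma dual_objectiveE eta Q L : dual_objective eta Q L = frob Q L - ln (Zpart eta Q L).
Proof. by rewrite ZpartE sintE. Qed.

Lemma weight_ge0 eta Q p : 0 <= weight eta Q p.
Proof. by rewrite /weight le_max lexx orbT. Qed.

Lemma bm_weight eta Q : bm (weight eta Q).
Proof. by apply: bm_max0; apply: bmB; [exact: bm_qf|exact: bm_cst]. Qed.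

Lemma bm_Zpart eta Q L : bm (fun p => expR (qf L p) * weight eta Q p).
Proof. by apply: bmM; [apply: bm_expR; exact: bm_qf|exact: bm_weight]. Qed.

Lemma gibbsE eta Q L p :
  gibbs eta Q L p = (Zpart eta Q L)^-1 * (expR (qf L p) * weight eta Q p).
Proof. by rewrite /gibbs mulrA. Qed.

Lemma bm_gibbs eta Q L : bm (gibbs eta Q L).
Proof.
by rewrite (funext (gibbsE eta Q L)); apply: bmM; [exact: bm_cst|exact: bm_Zpart].
Qed.

Lemma Zpart_ge0 eta Q L : 0 <= Zpart eta Q L.
Proof. by rewrite ZpartE; apply: sint_ge0 => p _; rewrite mulr_ge0 ?expR_ge0 ?weight_ge0. Qed.

Lemma gibbs_ge0 eta Q L p : 0 <= gibbs eta Q L p.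
Proof.
by rewrite gibbsE mulr_ge0 ?invr_ge0 ?Zpart_ge0// mulr_ge0 ?expR_ge0 ?weight_ge0.
Qed.

Lemma sint_gibbs eta Q L : 0 < Zpart eta Q L -> sint (gibbs eta Q L) = 1.
Proof.
move=> Z0; rewrite (funext (gibbsE eta Q L)) sintZ; last exact/bm_integrable/bm_Zpart.
rewrite -ZpartE; by rewrite mulVf// gt_eqF.
Qed.

Lemma density_gibbs eta Q L : 0 < Zpart eta Q L -> density (gibbs eta Q L).
Proof.
move=> Z0; split.
- exact/bm_integrable/bm_gibbs.
- by apply: aeS_all => p _; exact: gibbs_ge0.
- by rewrite -sintE; exact: sint_gibbs.
Qed.

Lemma ln_gibbs eta Q L p : 0 < Zpart eta Q L -> 0 < qf Q p - eta ->
  0 < gibbs eta Q L p /\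
  ln (gibbs eta Q L p) = qf L p - ln (Zpart eta Q L) + ln (qf Q p - eta).
Proof.
move=> Z0 u0; have wE : weight eta Q p = qf Q p - eta by rewrite /weight max_l// ltW.
rewrite /gibbs wE; have e0 := expR_gt0 (qf L p).
have Zi : 0 < (Zpart eta Q L)^-1 by rewrite invr_gt0.
split; first by rewrite !mulr_gt0.
by rewrite !lnM ?posrE ?mulr_gt0// lnV ?posrE// expRK; lra.
Qed.

Lemma gibbs_eq0 eta Q L p : qf Q p - eta <= 0 -> gibbs eta Q L p = 0.
Proof.
move=> u0; rewrite /gibbs /weight [Num.max _ _]max_r ?mulr0//.
Qed.

(** Where u > 0, ln g - ln u = L p . p - ln Z, so the energy involves only the mass and the moment
    of g. *)
Lemma energy_gibbs eta Q L : sym0 L -> 0 < Zpart eta Q L ->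
  moment (gibbs eta Q L) = Q ->
  energy eta (gibbs eta Q L) = (dual_objective eta Q L)%:E.
Proof.
move=> [_ trL] Z0 mQ; set g := gibbs eta Q L.
have bg : bm g by exact: bm_gibbs.
have Lg : L1 g by exact: bm_integrable.
rewrite energyE// mQ dual_objectiveE.
have -> : frob Q L - ln (Zpart eta Q L) =
    sint (fun p => g p * (qf L p - ln (Zpart eta Q L))).
  rewrite -{1}mQ frob_moment//.
  under [RHS]eq_sint => p _ do rewrite mulrBr.
  rewrite sintB; last 2 first.
  - exact/(L1M Lg)/bm_qf.
  - exact/(L1M Lg)/bm_cst.
  congr (_ - _); under eq_sint => p _ do rewrite mulrC.
  by rewrite sintZ// sint_gibbs// mulr1.
rewrite -integral_sint; last first.
  by apply: (L1M Lg); apply: bmB; [exact: bm_qf|exact: bm_cst].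
apply: eq_integral => p _.
have [u0|u0] := leP (qf Q p - eta) 0.
  by rewrite /g gibbs_eq0// !mul0r mul0e sube0.
have [g0 lng] := ln_gibbs (L := L) Z0 u0.
rewrite lne_EFin// -EFinM -EFinB; congr EFin.
by rewrite lng; lra.
Qed.

Lemma measurable_lne_EFin : measurable_fun [set: R] (fun x : R => lne x%:E).
Proof.
rewrite (_ : (fun x : R => lne x%:E) = (fun x => if x <= 0 then -oo%E else (ln x)%:E)).
  apply: measurable_fun_ifT.
  - by apply: measurable_fun_ler; [exact: measurable_id|exact: measurable_cst].
  - exact: measurable_cst.
  - by apply/measurable_EFinP; exact: measurable_ln.
by apply/funext => x.
Qed.

Lemma xlnx_ge (x : R) : 0 <= x -> x - 1 <= x * ln x.
Proof.
rewrite le_eqVlt => /predU1P[<-|x0]; first by rewrite mul0r; lra.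
have := @le_ln1Dx R (x^-1 - 1); rewrite (_ : 1 + (x^-1 - 1) = x^-1); last lra.
have xi : 0 < x^-1 by rewrite invr_gt0.
rewrite lnV ?posrE// => h.
have {}h : - ln x <= x^-1 - 1 by apply: h; lra.
have := ler_wpM2l (ltW x0) h; rewrite mulrBr mulfV ?gt_eqF//; lra.
Qed.

End energy.

Section finite_energy.
Context {R : realType}.
Local Notation cT := (caratheodory_type (hausdorff2_outer R)).
Local Notation S := (@sphere2 R).
Local Notation mu := (dS R).
Implicit Types (f g h : 'cV[R]_3 -> R) (p q : 'cV[R]_3) (A B L Q H : 'M[R]_3) (eta : R).

Let mS : measurable (S : set cT) := measurable_sphere (R := R).

Let aeF : Filter (nbhs (almost_everywhere (dS R))).
Proof. by typeclasses eauto. Qed.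

(* The integrand is bounded below by an integrable function almost everywhere,
   so an integral different from +oo makes it integrable. *)
Lemma integrable_of_lower_bound (I : cT -> \bar R) g : L1 g ->
  measurable_fun (S : set cT) I -> aeS (fun p => ((g p)%:E <= I p)%E) ->
  (\int[mu]_(p in S) I p < +oo)%E -> mu.-integrable S I.
Proof.
move=> Lg mI gI Ioo.
have mIp := measurable_funepos mI; have mIn := measurable_funeneg mI.
have Ln := L1_norm Lg.
have negoo : (\int[mu]_(p in S) I^\- p < +oo)%E.
  apply: (@le_lt_trans _ _ (\int[mu]_(p in S) (`|g p|)%:E)%E); last first.
    by rewrite integral_sint// ltry.
  apply: (ae_ge0_le_integral mS).
  - by move=> p _; exact: funeneg_ge0.
  - exact: mIn.
  - by move=> p _; rewrite lee_fin.
  - exact: measurable_int Ln.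
  - move: gI; rewrite /aeS; apply: (@filterS _ _ aeF) => p h Sp.
    rewrite funenegE ge_max; apply/andP; split; last by rewrite lee_fin.
    rewrite leeNl -EFinN; apply: le_trans (h Sp).
    by rewrite lee_fin lerNl ler_normr lexx orbT.
have neg0 : (0 <= \int[mu]_(p in S) I^\- p)%E by apply: integral_ge0 => p _; exact: funeneg_ge0.
have posoo : (\int[mu]_(p in S) I^\+ p < +oo)%E.
  move: Ioo; rewrite integralE.
  have nfin : (\int[mu]_(p in S) I^\- p)%E \is a fin_num by rewrite ge0_fin_numE.
  rewrite -(fineK nfin); case: (\int[mu]_(p in S) I^\+ p)%E => //= r _.
  exact: ltry.
apply/integrableP; split; first exact: mI.
rewrite (_ : (fun x => _) = (fun x => I^\+ x + I^\- x)%E); last first.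
  by apply/funext => p; have := congr1 (fun k => k p) (fune_abse I).
have Ip0 p : S p -> (0 <= I^\+ p)%E by move=> _; exact: funepos_ge0.
have In0 p : S p -> (0 <= I^\- p)%E by move=> _; exact: funeneg_ge0.
by rewrite (ge0_integralD mu mS Ip0 mIp In0 mIn); exact: lte_add_pinfty posoo negoo.
Qed.

(** The integrand of the energy has an integrable lower bound, so a finite energy makes it
    integrable and therefore finite almost everywhere; it equals +oo where u <= 0 < f. *)
Lemma finite_energy eta f : density f -> (energy eta f < +oo)%E ->
  let u p := qf (moment f) p - eta in
  let e p := f p * ln (f p) - f p * ln (u p) in
  [/\ aeS (fun p => u p <= 0 -> f p = 0), L1 e & energy eta f = (sint e)%:E].
Proof.
move=> [Lf f0 sf] + u e; rewrite energyE//.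
pose I (p : cT) : \bar R := ((f p * ln (f p))%:E - (f p)%:E * lne (u p)%:E)%E.
move=> Ioo; have {}Ioo : (\int[mu]_(p in S) I p < +oo)%E by exact: Ioo.
have mf := L1_measurable Lf.
have mu' : measurable_fun (S : set cT) (u : cT -> R).
  by apply: (bmB (bm_qf _) (bm_cst _)).1.
have mln k : measurable_fun (S : set cT) (k : cT -> R) ->
    measurable_fun (S : set cT) (fun p : cT => ln (k p)).
  by move=> mk; apply: measurableT_comp => //; exact: measurable_ln.
have me : measurable_fun (S : set cT) (e : cT -> R).
  apply: measurable_funB; apply: measurable_funM; [exact: mf|exact: mln|exact: mf|exact: mln].
have mI : measurable_fun (S : set cT) (I : cT -> \bar R).
  apply: emeasurable_funB.
    by apply/measurable_EFinP; apply: measurable_funM; [exact: mf|exact: mln].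
  apply: emeasurable_funM; first exact/measurable_EFinP.
  by apply: (measurableT_comp (@measurable_lne_EFin R) mu').
pose K := 9 * `|moment f| + `|eta|.
have uK p : S p -> u p <= K.
  move=> Sp; have := normr_qf_le (moment f) Sp; rewrite /u /K ler_norml => /andP[_ h].
  by have := ler_norm (- eta); rewrite normrN; lra.
(* The lower bound comes from x ln x >= x - 1 >= -1 and ln u <= u - 1 <= K. *)
have Lg : L1 (fun p => -1 - K * f p).
  by apply: L1B; [exact/bm_integrable/bm_cst|exact: L1Z].
have Iint : mu.-integrable S I.
  apply: (integrable_of_lower_bound Lg mI _ Ioo).
  apply: (aeS_imp f0) => p Sp fp; rewrite /I.
  have h1 := xlnx_ge fp.
  have [u0|u0] := leP (u p) 0.
    rewrite le0_lneNy; last by rewrite lee_fin.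
    have [fp0|fp0] := eqVneq (f p) 0.
      by rewrite fp0 mul0r mul0e sube0 mulr0 lee_fin; lra.
    have fpos : 0 < f p by rewrite lt_def fp0.
    by rewrite mulrNy gtr0_sg// mul1e /= addey// leey.
  rewrite lne_EFin// -EFinM -EFinB lee_fin.
  have h2 : ln (u p) <= K.
    apply: le_trans (_ : u p <= K); last exact: uK.
    by have := @le_ln1Dx R (u p - 1); rewrite (_ : 1 + (u p - 1) = u p); [move=> h; have := h _|]; lra.
  have := ler_wpM2l fp h2; lra.
have Ifin := integrable_ae mS Iint.
have fu : aeS (fun p => u p <= 0 -> f p = 0).
  apply: (aeS_imp2 f0 Ifin) => p Sp fp; rewrite /I => + u0.
  rewrite le0_lneNy; last by rewrite lee_fin.
  apply: contraTeq => fp0; have fpos : 0 < f p by rewrite lt_def fp0.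
  by rewrite mulrNy gtr0_sg// mul1e.
have Ie : aeS (fun p => I p = (e p)%:E).
  apply: (aeS_imp fu) => p Sp hu; rewrite /I /e.
  have [u0|u0] := leP (u p) 0; first by rewrite hu// !mul0r mul0e sube0 subr0.
  by rewrite lne_EFin.
have IeE : ae_eq mu S I (EFin \o e).
  by move: Ie; rewrite /aeS; apply: (@filterS _ _ aeF) => p h Sp /=; rewrite h.
have meE : measurable_fun (S : set cT) (EFin \o e) by exact/measurable_EFinP.
have Le : L1 e.
  apply/integrableP; split; first exact: meE.
  have /integrableP[_ h] := Iint.
  have mI2 : measurable_fun (S : set cT) (abse \o I).
    by apply: measurableT_comp; [exact: abse_measurable|exact: mI].
  have me2 : measurable_fun (S : set cT) (abse \o (EFin \o e)).
    by apply: measurableT_comp; [exact: abse_measurable|exact: meE].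
  rewrite -(ae_eq_integral _ _ mS mI2 me2)//.
  by move: Ie; rewrite /aeS; apply: (@filterS _ _ aeF) => p h' Sp /=; rewrite h'.
split => //.
by rewrite -integral_sint//; exact: (ae_eq_integral _ _ mS mI meE IeE).
Qed.

(** With z = ln (y / x), this is exp z >= 1 + z multiplied by x, and the inequality is strict unless
    z = 0. *)
Lemma entropy_gap (x y : R) : 0 < x -> 0 < y ->
  x - y <= x * (ln x - ln y) /\ (x * (ln x - ln y) = x - y -> x = y).
Proof.
move=> x0 y0; pose z := ln y - ln x.
have yE : y = x * expR z by rewrite /z expRB !lnK ?posrE// mulrCA mulfV ?gt_eqF// mulr1.
have -> : ln x - ln y = - z by rewrite /z; lra.
have [z0|z0] := eqVneq z 0.
  by rewrite yE z0 expR0 mulr1; split; lra.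
have := expR_gt1Dx z0; rewrite -(ltr_pM2l x0) -yE => h; split; first by lra.
by move=> h'; lra.
Qed.

(* Pointwise, the integrand of the energy minus the affine functional whose
   integral is the dual objective is x ln (x/y) - x + y for x = f and y the Gibbs
   density. *)
Lemma energy_le_dual_gibbs eta f L : density f -> sym0 L ->
  0 < Zpart eta (moment f) L -> (energy eta f < +oo)%E ->
  (energy eta f <= (dual_objective eta (moment f) L)%:E)%E ->
  aeS (fun p => f p = gibbs eta (moment f) L p).
Proof.
move=> df [_ trL] Z0 foo; have [Lf f0 sf] := df.
have [fu Le ->] := finite_energy df foo.
set Q := moment f in Z0 fu Le *.
pose e p := f p * ln (f p) - f p * ln (qf Q p - eta).
rewrite lee_fin -/e => le.
pose g := gibbs eta Q L; pose c := ln (Zpart eta Q L).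
have Lg : L1 g by exact/bm_integrable/bm_gibbs.
have Lq : L1 (fun p => f p * qf L p) by exact/(L1M Lf)/bm_qf.
(* The term f - g integrates to 0, as both have mass one, and it makes e - a nonnegative
   pointwise. *)
pose a p := (f p * qf L p - c * f p) + (f p - g p).
have La1 : L1 (fun p => f p * qf L p - c * f p) by apply: L1B => //; exact: L1Z.
have La2 : L1 (fun p => f p - g p) by exact: L1B.
have La : L1 a by exact: L1D.
have sa : sint a = dual_objective eta Q L.
  rewrite /a sintD// !sintB//; last exact: L1Z.
  rewrite sintZ// (sint_gibbs Z0) dual_objectiveE -/c.
  have -> : sint f = 1 by rewrite sintE; exact: sf.
  by rewrite -frob_moment// -/Q; lra.
have pw : aeS (fun p => a p <= e p /\ (e p = a p -> f p = g p)).
  apply: (aeS_imp2 f0 fu) => p Sp fp hu; rewrite /a /e.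
  have [u0|u0] := leP (qf Q p - eta) 0.
    by rewrite hu// /g gibbs_eq0//; split; lra.
  have [g0 lng] := ln_gibbs (L := L) Z0 u0.
  rewrite -/g in g0 lng *; rewrite -/c in lng.
  have [fp0|fp0] := eqVneq (f p) 0.
    by rewrite fp0; split; lra.
  have fpos : 0 < f p by rewrite lt_def fp0.
  have [h1 h2] := entropy_gap fpos g0.
  have E : f p * ln (f p) - f p * ln (qf Q p - eta) -
    (f p * qf L p - c * f p + (f p - g p)) =
    f p * (ln (f p) - ln (g p)) - (f p - g p) by rewrite lng; lra.
  by split; [lra|move=> E'; apply: h2; lra].
have d0 : aeS (fun p => e p - a p = 0).
  apply: sint_le0_ae; first exact: L1B.
    by apply: (aeS_imp pw) => p _ [h _]; rewrite subr_ge0.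
  by rewrite sintB// sa; lra.
by apply: (aeS_imp2 pw d0) => p _ [_ h] h'; apply: h; lra.
Qed.

End finite_energy.

(** * Extrema over compact sets of traceless symmetric matrices *)

Section compactness.
Context {R : realType}.
Implicit Types (A B L : 'M[R]_3).

Lemma lipschitz_continuous (V W : normedModType R) (F : V -> W) (K : R) :
  (forall x y, `|F x - F y| <= K * `|x - y|) -> continuous F.
Proof.
move=> lip x; apply/cvgrPdist_lt => e e0.
have K1 : 0 < `|K| + 1 by rewrite ltr_wpDl.
have eK : 0 < (`|K| + 1)^-1 * e by rewrite mulr_gt0 ?invr_gt0.
have idx : (fun y : V => y) y @[y --> x] --> x by exact: cvg_id.
have /cvgrPdist_lt/(_ _ eK) := idx.
apply: filterS => y; rewrite ltr_pdivlMl// => h.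
apply: le_lt_trans (lip x y) (le_lt_trans _ h).
by rewrite ler_wpM2r//; have := ler_norm K; lra.
Qed.

Lemma normr_mx_le (m n : nat) (M : 'M[R]_(m, n)) i j : `|M i j| <= `|M|.
Proof. by rewrite [leRHS]mx_normrE; apply: (le_bigmax _ (fun ij => `|M ij.1 ij.2|) (i, j)). Qed.

Lemma mx_norm_le (m n : nat) (M : 'M[R]_(m, n)) (c : R) : 0 <= c ->
  (forall i j, `|M i j| <= c) -> `|M| <= c.
Proof. by move=> c0 h; rewrite [leLHS]mx_normrE; apply: bigmax_le. Qed.

(** Taking a = 0 gives balls around A, taking a = b gives spheres. Compactness of closed bounded
    sets is used for row vectors and carried to matrices by [vec_mx]. *)
Lemma sym0_EVT (F : 'M[R]_3 -> R) (K : R) A (a b : R) :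
  (forall L L', `|F L - F L'| <= K * `|L - L'|) ->
  (exists L, [/\ sym0 L, a <= `|L - A| & `|L - A| <= b]) ->
  exists L1, [/\ sym0 L1, a <= `|L1 - A|, `|L1 - A| <= b &
    forall L, sym0 L -> a <= `|L - A| -> `|L - A| <= b -> F L <= F L1].
Proof.
move=> lip [L0 [sL0 aL0 bL0]].
pose v : 'rV[R]_(3 * 3) -> 'M[R]_3 := vec_mx.
have vlip x y : `|v x - v y| <= 1 * `|x - y|.
  rewrite mul1r /v -linearB; apply: mx_norm_le => // i j.
  by rewrite mxE; exact: normr_mx_le.
have cont (G : 'M[R]_3 -> R) k : (forall L L', `|G L - G L'| <= k * `|L - L'|) ->
    continuous (G \o v).
  move=> Gl x; apply: continuous_comp; first exact: (lipschitz_continuous vlip).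
  exact: (@lipschitz_continuous 'M[R]_3 R^o G k Gl).
have clo (G : 'M[R]_3 -> R) k (c : R) :
    (forall L L', `|G L - G L'| <= k * `|L - L'|) -> closed [set x | G (v x) <= c].
  move=> Gl; have /continuous_closedP := cont G k Gl.
  by move=> /(_ _ (@closed_le R c)).
have dist L L' : `| `|L - A| - `|L' - A| | <= 1 * `|L - L'|.
  by rewrite mul1r; apply: le_trans (ler_dist_dist _ _) _; rewrite opprB addrA subrK.
(* Symmetry and vanishing trace become a sublevel set of one Lipschitz function, so that [clo]
   covers all the constraints. *)
pose asym L : R := `|L - L^T| + `|\tr L|.
have asymlip L L' : `|asym L - asym L'| <= 5 * `|L - L'|.
  have trn (M : 'M[R]_3) : `|M^T| <= `|M|.
    by apply: mx_norm_le => // i j; rewrite mxE; exact: normr_mx_le.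
  have tr3 (M : 'M[R]_3) : `|\tr M| <= 3 * `|M|.
    rewrite /mxtrace; apply: le_trans (ler_norm_sum _ _ _) _.
    apply: (@le_trans _ _ (\sum_(i < 3) `|M|)).
      by apply: ler_sum => i _; exact: normr_mx_le.
    by rewrite sumr_const card_ord; lra.
  have h1 := ler_dist_dist (L - L^T) (L' - L'^T).
  have h2 : `|(L - L^T) - (L' - L'^T)| <= 2 * `|L - L'|.
    rewrite (_ : _ - _ = (L - L') - (L - L')^T); last first.
      by apply/matrixP => i j; rewrite !mxE; lra.
    apply: le_trans (ler_normB _ _) _.
    by have := trn (L - L'); lra.
  have h3 := ler_dist_dist (\tr L) (\tr L').
  have h4 : `|\tr L - \tr L'| <= 3 * `|L - L'| by rewrite -raddfB; exact: tr3.
  rewrite (_ : asym L - asym L' = (`|L - L^T| - `|L' - L'^T|) + (`|\tr L| - `|\tr L'|)).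
    by apply: le_trans (ler_normD _ _) _; lra.
  by rewrite /asym; lra.
have symE L : sym0 L <-> asym L <= 0.
  split=> [[Ls Lt]|h]; first by rewrite /asym Ls Lt subrr !normr0 addr0.
  have h1 := normr_ge0 (L - L^T); have h2 := normr_ge0 (\tr L).
  have e1 : `|L - L^T| == 0 by rewrite /asym in h; apply/eqP; lra.
  have e2 : `|\tr L| == 0 by rewrite /asym in h; apply/eqP; lra.
  rewrite !normr_eq0 subr_eq0 in e1 e2.
  by split; [rewrite -(eqP e1)|exact/eqP].
pose X : set 'rV[R]_(3 * 3) := [set x | asym (v x) <= 0] `&`
  ([set x | - `|v x - A| <= - a] `&` [set x | `|v x - A| <= b]).
have cX : compact X.
  apply: bounded_closed_compact.
    exists (b + `|A|); split; first exact: num_real.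
    move=> M bM x [_ [_ /= xb]]; apply: le_trans (ltW bM).
    apply: mx_norm_le; first by have := normr_ge0 (v x - A); have := normr_ge0 A; lra.
    move=> i j; rewrite ord1; case/mxvec_indexP: j => k l.
    rewrite (_ : x 0 _ = v x k l); last by rewrite mxE.
    apply: le_trans (normr_mx_le _ _ _) _.
    rewrite -[v x](subrK A); apply: le_trans (ler_normD _ _) _.
    by rewrite lerD2r.
  apply: closedI; first exact: (clo _ _ _ asymlip).
  apply: closedI; last exact: (clo _ _ _ dist).
  apply: (clo (fun L => - `|L - A|) 1) => L L'.
  by rewrite -opprD normrN; exact: dist.
have X0 : X !=set0.
  exists (mxvec L0); rewrite /X /v; split => /=; rewrite mxvecK; first exact/symE.
  by split => //; rewrite lerN2.
have [c cXin cmax] := compact_EVT_max X0 cX (continuous_subspaceT (cont F K lip)).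
have [/symE sc [/= ac bc]] := set_mem cXin; rewrite lerN2 in ac.
exists (v c); split => // L sL aL bL.
have := cmax (mxvec L); rewrite /= /v mxvecK; apply; apply/mem_set.
by rewrite /X /v; split => /=; rewrite mxvecK; [exact/symE|split => //; rewrite lerN2].
Qed.

End compactness.

(** * The dual problem *)

Section dual.
Context {R : realType}.
Implicit Types (f g h : 'cV[R]_3 -> R) (p q : 'cV[R]_3) (A B L Q H : 'M[R]_3) (eta : R).

(** From exp (-x) >= 1 - x follows exp x <= 1 / (1 - x), and (1 + x + 2 x^2)(1 - x) = 1 + x^2 (1 - 2
    x) >= 1. *)
Lemma expR_le_quad (x : R) : `|x| <= 1 / 2 -> expR x <= 1 + x + 2 * x ^+ 2.
Proof.
rewrite ler_norml => /andP[x1 x2].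
have h := expR_ge1Dx (- x); have e0 := expR_gt0 x.
have x0 : 0 < 1 - x by lra.
have : expR x * (1 - x) <= 1.
  have := ler_wpM2l (ltW e0) h; rewrite -expRD subrr expR0.
  by [].
rewrite -ler_pdivlMr// => /le_trans; apply; rewrite ler_pdivrMr//.
have := mulr_ge0 (sqr_ge0 x) (_ : 0 <= 1 - 2 * x) => h'.
have {h'} : 0 <= x ^+ 2 * (1 - 2 * x) by apply: h'; lra.
lra.
Qed.

(** This replaces the comparison of derivatives at 0: divide by a small t of either sign. *)
Lemma first_order_eq (a b C d : R) : 0 < d -> 0 <= C ->
  (forall t, `|t| < d -> t * a <= t * b + C * t ^+ 2) -> a = b.
Proof.
move=> d0 C0 h.
have key (x y : R) : (forall t, 0 < t -> t < d -> t * x <= t * y + C * t ^+ 2) -> x <= y.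
  move=> hxy; apply/ler_addgt0Pr => e e0.
  pose t := Num.min (d / 2) (e / (C + 1)).
  have t0 : 0 < t by rewrite lt_min !divr_gt0//; lra.
  have td : t < d by rewrite gt_min; apply/orP; left; lra.
  have te : t * (C + 1) <= e by rewrite -ler_pdivlMr ?ge_min ?lexx ?orbT//; lra.
  have := hxy t t0 td; rewrite expr2 mulrCA -mulrDr ler_pM2l//; nra.
apply/eqP; rewrite eq_le; apply/andP; split; apply: key => t t0 td.
  by apply: h; rewrite gtr0_norm.
by have := h (- t); rewrite normrN gtr0_norm// => /(_ td); rewrite sqrrN; lra.
Qed.

Lemma Zpart_le_expR eta Q L L' :
  Zpart eta Q L' <= expR (9 * `|L' - L|) * Zpart eta Q L.
Proof.
rewrite !ZpartE -sintZ; last exact/bm_integrable/bm_Zpart.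
apply: le_sint.
- exact/bm_integrable/bm_Zpart.
- exact/bm_integrable/bmM/bm_Zpart/bm_cst.
move=> p Sp; rewrite mulrA ler_wpM2r ?weight_ge0// -expRD ler_expR.
have := normr_qf_le (L' - L) Sp; rewrite qfB ler_norml => /andP[_]; lra.
Qed.

Lemma Zpart_gt0 eta Q L L' : 0 < Zpart eta Q L -> 0 < Zpart eta Q L'.
Proof.
move=> Z0; have := lt_le_trans Z0 (Zpart_le_expR eta Q L' L).
by rewrite pmulr_rgt0// expR_gt0.
Qed.

Lemma dual_objective_lipschitz eta Q L L' : 0 < Zpart eta Q 0 ->
  `|dual_objective eta Q L - dual_objective eta Q L'| <= (9 * `|Q| + 9) * `|L - L'|.
Proof.
move=> Z0; have pos := Zpart_gt0 _ Z0.
have le M M' : ln (Zpart eta Q M') <= 9 * `|M' - M| + ln (Zpart eta Q M).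
  have e0 := expR_gt0 (9 * `|M' - M|).
  have <- : ln (expR (9 * `|M' - M|) * Zpart eta Q M) =
      9 * `|M' - M| + ln (Zpart eta Q M) by rewrite lnM ?posrE ?pos// expRK.
  rewrite ler_ln ?posrE ?pos// ?mulr_gt0 ?pos//.
  exact: Zpart_le_expR.
rewrite !dual_objectiveE.
have := normr_frob_le Q (L - L'); rewrite frobBr ler_norml => /andP[h1 h2].
have := le L L'; have := le L' L; rewrite (distrC L' L) => h3 h4.
move: (frob Q L) (frob Q L') (ln (Zpart eta Q L)) (ln (Zpart eta Q L'))
  `|Q| `|L - L'| h1 h2 h3 h4 => {le pos Z0} a a' b b' c d h1 h2 h3 h4.
by rewrite ler_norml; apply/andP; split; lra.
Qed.

(** Comparison with L + t H gives t Q . H <= ln (Z' / Z). Expanding exp (t H p . p) to second order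
    under the integral bounds the right side by t m + O(t^2), where m pairs H with the moment. *)
Lemma gibbs_stationary eta Q L (r : R) : sym0 Q -> sym0 L -> 0 < r ->
  0 < Zpart eta Q L ->
  (forall L', sym0 L' -> `|L' - L| < r ->
    dual_objective eta Q L' <= dual_objective eta Q L) ->
  moment (gibbs eta Q L) = Q.
Proof.
move=> sQ sL r0 Z0 hmax; set g := gibbs eta Q L.
have bg : bm g by exact: bm_gibbs.
have Lg : L1 g by exact: bm_integrable.
apply: sym0_frob_inj => //; first exact: sym0_moment.
move=> H sH; rewrite (frob_moment Lg sH.2); apply/esym.
set m := sint _; pose k := `|H|; have k0 : 0 <= k := normr_ge0 H.
(* The first bound keeps L + t H in the ball of radius r; the second keeps |t H p . p| below 1/2, as
   [expR_le_quad] requires. *)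
pose d := Num.min (r / (k + 1)) (1 / (18 * (k + 1))).
have k1 : 0 < k + 1 by lra.
have d0 : 0 < d by rewrite lt_min !divr_gt0//; lra.
apply: (@first_order_eq _ _ (162 * k ^+ 2) d) => //.
  by rewrite mulr_ge0 ?sqr_ge0.
move=> t td; have t0 := normr_ge0 t.
have tr : `|t| * (k + 1) < r.
  by rewrite -ltr_pdivlMr//; apply: lt_le_trans td _; rewrite ge_min lexx.
have ts : `|t| * (18 * (k + 1)) < 1.
  rewrite -ltr_pdivlMr; last by lra.
  by apply: lt_le_trans td _; rewrite ge_min lexx orbT.
have Z'0 : 0 < Zpart eta Q (L + t *: H) by exact: Zpart_gt0 Z0.
have := hmax (L + t *: H) (sym0D sL (sym0Z t sH)).
rewrite addrAC subrr add0r normrZ -/k => /(_ _)/=.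
have tk : `|t| * k < r by nra.
move=> /(_ tk); rewrite !dual_objectiveE frobDr frobZr => h.
set Z := Zpart eta Q L in Z0 h *.
set Z' := Zpart eta Q _ in Z'0 h *.
have bH : bm (fun p => t * qf H p) by apply: bmM; [exact: bm_cst|exact: bm_qf].
have Z'le : Z' <= Z * (1 + t * m + 162 * k ^+ 2 * t ^+ 2).
  apply: (@le_trans _ _ (sint (fun p => Z * (g p * (1 + 162 * k ^+ 2 * t ^+ 2) +
      t * (g p * qf H p))))).
    rewrite /Z' ZpartE; apply: le_sint.
    - exact/bm_integrable/bm_Zpart.
    - apply: L1Z; apply: L1D; first by apply: (L1M Lg); exact: bm_cst.
      by apply: L1Z; apply: (L1M Lg); exact: bm_qf.
    move=> p Sp; rewrite /g gibbsE -/Z.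
    set w := weight eta Q p; have w0 : 0 <= w := weight_ge0 _ _ _.
    have qH := normr_qf_le H Sp; rewrite -/k in qH.
    have tq : `|t * qf H p| <= 1 / 2.
      rewrite normrM; have := ler_wpM2l t0 qH; nra.
    have tq2 : (t * qf H p) ^+ 2 <= 81 * k ^+ 2 * t ^+ 2.
      rewrite exprMn -(real_normK (num_real (qf H p))).
      have : `|qf H p| ^+ 2 <= (9 * k) ^+ 2 by rewrite ler_sqr ?nnegrE// mulr_ge0.
      have := sqr_ge0 t; rewrite exprMn; nra.
    have ee := expR_le_quad tq.
    rewrite qfD qfZ expRD.
    rewrite (_ : Z * _ = (expR (qf L p) * w) * (1 + t * qf H p + 162 * k ^+ 2 * t ^+ 2)); last first.
      set E := expR _ * w; rewrite (_ : _ + _ = Z^-1 * (E * (1 + t * qf H p + 162 * k ^+ 2 * t ^+ 2))).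
        by rewrite mulrA mulfV ?gt_eqF// mul1r.
      by lra.
    rewrite mulrAC ler_wpM2l ?mulr_ge0 ?expR_ge0//; lra.
  rewrite sintZ; last first.
    apply: L1D; first by apply: (L1M Lg); exact: bm_cst.
    by apply: L1Z; apply: (L1M Lg); exact: bm_qf.
  rewrite ler_pM2l// sintD; last 2 first.
  - by apply: (L1M Lg); exact: bm_cst.
  - by apply: L1Z; apply: (L1M Lg); exact: bm_qf.
  rewrite sintZ; last by apply: (L1M Lg); exact: bm_qf.
  rewrite (_ : sint (fun p => g p * _) = 1 + 162 * k ^+ 2 * t ^+ 2); first by rewrite -/m; lra.
  under eq_sint => p _ do rewrite mulrC.
  by rewrite sintZ// sint_gibbs// mulr1.
have y0 : 0 < 1 + t * m + 162 * k ^+ 2 * t ^+ 2.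
  by have := lt_le_trans Z'0 Z'le; rewrite pmulr_rgt0.
have : ln Z' <= ln Z + (t * m + 162 * k ^+ 2 * t ^+ 2).
  apply: (@le_trans _ _ (ln (Z * (1 + t * m + 162 * k ^+ 2 * t ^+ 2)))).
    by rewrite ler_ln ?posrE// mulr_gt0.
  rewrite lnM ?posrE// lerD2l -addrA; apply: le_ln1Dx.
  by move: y0; rewrite -addrA -ltrBlDl sub0r.
move: (ln Z) (ln Z') (frob Q L) (frob Q H) h (162 * k ^+ 2 * t ^+ 2) (t * m).
by move=> x x' y y' h z z' h'; move: (t * y') h => w h; lra.
Qed.

End dual.

Section argmax.
Context {R : realType}.
Implicit Types (f g h : 'cV[R]_3 -> R) (p q : 'cV[R]_3) (A B L Q H : 'M[R]_3) (eta : R).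

Lemma sint_ae0 g : L1 g -> aeS (fun p => g p = 0) -> sint g = 0.
Proof.
move=> Lg g0; rewrite -(@sint0 R); apply: ae_eq_sint => //.
exact/bm_integrable/bm_cst.
Qed.

(** Mass one cannot sit on a null set. This rigidity yields the injectivity of the Gibbs density in
    L, the coercivity of the dual objective and the strict bound on the eigenvalues of a moment. *)
Lemma density_quadric g B : L1 g -> sint g = 1 -> B^T = B ->
  aeS (fun p => g p * qf B p = 0) -> B = 0.
Proof.
move=> Lg sg Bs gB; apply/eqP; apply: contraT => B0.
have := oner_neq0 R; rewrite -sg sint_ae0 ?eqxx//.
apply: (aeS_imp2 gB (quadric_ae Bs B0)) => p _ /eqP.
by rewrite mulf_eq0 => /orP[/eqP//|->].
Qed.

(** If Z vanished, u would be nonpositive almost everywhere, and so g would vanish almost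
    everywhere. *)
Lemma Zpart_gt0_of_density eta Q L g : L1 g -> sint g = 1 ->
  aeS (fun p => qf Q p - eta <= 0 -> g p = 0) -> 0 < Zpart eta Q L.
Proof.
move=> Lg sg gu; rewrite lt_def Zpart_ge0 andbT; apply/eqP => Z0.
have := oner_neq0 R; rewrite -sg sint_ae0 ?eqxx//.
have w0 : aeS (fun p => expR (qf L p) * weight eta Q p = 0).
  apply: sint_le0_ae; first exact/bm_integrable/bm_Zpart.
    by apply: aeS_all => p _; rewrite mulr_ge0 ?expR_ge0 ?weight_ge0.
  by rewrite -ZpartE Z0.
apply: (aeS_imp2 w0 gu) => p _ /eqP; rewrite mulf_eq0 gt_eqF ?expR_gt0//= => /eqP w h.
by apply: h; rewrite -w /weight le_max lexx.
Qed.

Lemma sym0_scalar_eq0 L (c : R) : sym0 L -> L - c%:M = 0 -> c = 0 /\ L = 0.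
Proof.
move=> [_ trL] /eqP; rewrite subr_eq0 => /eqP LE.
have c0 : c = 0.
  by move: trL; rewrite LE mxtrace_scalar => /eqP; rewrite mulrn_eq0 => /eqP.
by split => //; rewrite LE c0; apply/matrixP => i j; rewrite !mxE mul0rn.
Qed.

(** Taking logarithms where u > 0, (L - L') p . p is a constant c. On the sphere this is the quadric
    of L - L' - c I, and it carries all the mass of the density. *)
Lemma gibbs_inj eta Q L L' : sym0 L -> sym0 L' ->
  0 < Zpart eta Q L -> 0 < Zpart eta Q L' ->
  aeS (fun p => gibbs eta Q L p = gibbs eta Q L' p) -> L = L'.
Proof.
move=> sL sL' Z0 Z'0 gg; pose c := ln (Zpart eta Q L) - ln (Zpart eta Q L').
have sLL := sym0B sL sL'.
have B0 : L - L' - c%:M = 0.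
  apply: (@density_quadric (gibbs eta Q L)).
  - exact/bm_integrable/bm_gibbs.
  - exact: sint_gibbs.
  - by rewrite linearB/= sLL.1 tr_scalar_mx.
  apply: (aeS_imp gg) => p Sp e.
  have [u0|u0] := leP (qf Q p - eta) 0; first by rewrite gibbs_eq0// mul0r.
  have [_ h] := ln_gibbs (L := L) Z0 u0; have [_ h'] := ln_gibbs (L := L') Z'0 u0.
  rewrite qfB qf_scalar// qfB; move: h'; rewrite -e h /c.
  move: (ln (Zpart eta Q L)) (ln (Zpart eta Q L')) (ln _) => x y z h'.
  by rewrite [X in _ * X](_ : _ = 0) ?mulr0//; lra.
by have [_ /eqP] := sym0_scalar_eq0 sLL B0; rewrite subr_eq0 => /eqP.
Qed.

Definition tilt eta Q L : R :=
  sint (fun p => Num.max (qf L p - frob Q L) 0 * weight eta Q p).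

Lemma bm_tilt eta Q L : bm (fun p => Num.max (qf L p - frob Q L) 0 * weight eta Q p).
Proof.
apply: bmM; last exact: bm_weight.
by apply: bm_max0; apply: bmB; [exact: bm_qf|exact: bm_cst].
Qed.

Lemma tilt_ge0 eta Q L : 0 <= tilt eta Q L.
Proof. by apply: sint_ge0 => p _; rewrite mulr_ge0 ?weight_ge0// le_max lexx orbT. Qed.

Lemma tiltZ eta Q L (c : R) : 0 <= c -> tilt eta Q (c *: L) = c * tilt eta Q L.
Proof.
move=> c0; rewrite /tilt -sintZ; last exact/bm_integrable/bm_tilt.
apply: eq_sint => p _; rewrite qfZ frobZr -mulrBr mulrA; congr (_ * _).
by rewrite maxr_pMr// mulr0.
Qed.

Lemma tilt_lipschitz eta Q L L' :
  `|tilt eta Q L - tilt eta Q L'| <=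
  (9 + 9 * `|Q|) * sint (weight eta Q) * `|L - L'|.
Proof.
have le M M' : tilt eta Q M <= tilt eta Q M' +
    (9 + 9 * `|Q|) * `|M - M'| * sint (weight eta Q).
  rewrite /tilt -sintZ; last exact/bm_integrable/bm_weight.
  rewrite -sintD; last 2 first.
  - exact/bm_integrable/bm_tilt.
  - exact/L1Z/bm_integrable/bm_weight.
  apply: le_sint; first exact/bm_integrable/bm_tilt.
    apply: L1D; first exact/bm_integrable/bm_tilt.
    exact/L1Z/bm_integrable/bm_weight.
  move=> p Sp; rewrite -mulrDl ler_wpM2r ?weight_ge0//.
  have := normr_qf_le (M - M') Sp; rewrite qfB ler_norml => /andP[_ h1].
  have := normr_frob_le Q (M - M'); rewrite frobBr ler_norml => /andP[h2 _].
  have h3 := normr_ge0 Q; have h4 := normr_ge0 (M - M').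
  have h5 : 0 <= (9 + 9 * `|Q|) * `|M - M'| by rewrite mulr_ge0//; lra.
  have h6 : qf M' p - frob Q M' <= Num.max (qf M' p - frob Q M') 0 by rewrite le_max lexx.
  have h7 : 0 <= Num.max (qf M' p - frob Q M') 0 by rewrite le_max lexx orbT.
  by rewrite ge_max; apply/andP; split; lra.
rewrite mulrAC ler_norml; have := le L L'; have := le L' L; rewrite (distrC L' L).
by move=> h1 h2; apply/andP; split; lra.
Qed.

(** If [tilt] vanished, L p . p <= Q . L would hold where u > 0. But Q . L is the mean of L p . p
    under g, so equality would hold on the support of g, which would then lie in a quadric. *)
Lemma tilt_gt0 eta g L : L1 g -> sint g = 1 -> aeS (fun p => 0 <= g p) ->
  let Q := moment g in aeS (fun p => qf Q p - eta <= 0 -> g p = 0) ->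
  sym0 L -> L != 0 -> 0 < tilt eta Q L.
Proof.
move=> Lg sg g0 Q gu sL L0; rewrite ltNge; apply: contraNN L0 => t0.
have w0 : aeS (fun p => Num.max (qf L p - frob Q L) 0 * weight eta Q p = 0).
  apply: sint_le0_ae t0; first exact/bm_integrable/bm_tilt.
  by apply: aeS_all => p _; rewrite mulr_ge0 ?weight_ge0// le_max lexx orbT.
pose B := L - (frob Q L)%:M.
have Bs : B^T = B by rewrite /B linearB/= sL.1 tr_scalar_mx.
have Lqf M : L1 (fun p => g p * qf M p) by exact/(L1M Lg)/bm_qf.
have np : aeS (fun p => 0 <= - (g p * qf B p)).
  apply: (aeS_imp2 w0 (_ : aeS (fun p => 0 <= g p /\ (qf Q p - eta <= 0 -> g p = 0)))).
    by apply: (aeS_imp2 g0 gu) => p _.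
  move=> p Sp wp [gp gup].
  have [u0|u0] := leP (qf Q p - eta) 0; first by rewrite gup// mul0r oppr0.
  move: wp => /eqP; rewrite mulf_eq0 => /orP[|]; last first.
    by rewrite /weight max_l ?gt_eqF// ltW.
  move=> /eqP m0; rewrite -mulrN mulr_ge0// oppr_ge0 qfB qf_scalar//.
  by rewrite -m0 le_max lexx.
have s0 : sint (fun p => - (g p * qf B p)) = 0.
  rewrite sintN//; under eq_sint => p Sp do rewrite qfB qf_scalar// mulrBr mulrC [g p * frob _ _]mulrC.
  under eq_sint => p Sp do rewrite mulrC.
  rewrite sintB//; last exact: L1Z.
  by rewrite sintZ// sg -frob_moment ?sL.2// mulr1 subrr oppr0.
have gB : aeS (fun p => g p * qf B p = 0).
  have LN : L1 (fun p => - (g p * qf B p)).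
    under eq_fun do rewrite -mulN1r.
    exact: L1Z.
  have := sint_le0_ae LN np; rewrite s0 lexx => /(_ isT) h.
  by apply: (aeS_imp h) => p _ /eqP; rewrite oppr_eq0 => /eqP.
have [_ ->] := sym0_scalar_eq0 sL (density_quadric Lg sg Bs gB).
by rewrite eqxx.
Qed.

(** By positive homogeneity c can be the minimum of [tilt] over unit matrices, which compactness
    provides. *)
Lemma tilt_coercive eta g : L1 g -> sint g = 1 -> aeS (fun p => 0 <= g p) ->
  let Q := moment g in aeS (fun p => qf Q p - eta <= 0 -> g p = 0) ->
  exists2 c, 0 < c & forall L, sym0 L -> c * `|L| <= tilt eta Q L.
Proof.
move=> Lg sg g0 Q gu.
have Flip L L' : `|- tilt eta Q L - - tilt eta Q L'| <=
    (9 + 9 * `|Q|) * sint (weight eta Q) * `|L - L'|.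
  by rewrite -opprD normrN; exact: tilt_lipschitz.
have nz L : sym0 L -> L != 0 -> sym0 (`|L|^-1 *: L) /\ `|(`|L|^-1 *: L)| = 1.
  move=> sL L0; split; first exact: sym0Z.
  by rewrite normrZ ger0_norm ?invr_ge0// mulVf// normr_eq0.
have [[L0 [sL0 nL0]]|none] := pselect (exists L, sym0 L /\ L != 0); last first.
  exists 1 => // L sL; have [->|L0] := eqVneq L 0; first by rewrite normr0 mulr0 tilt_ge0.
  by exfalso; apply: none; exists L.
have [|L1' [sL1 h1 h1' L1max]] := sym0_EVT (A := 0) (a := 1) (b := 1) Flip.
  have [s n] := nz _ sL0 nL0.
  by exists (`|L0|^-1 *: L0); rewrite subr0 n.
rewrite subr0 in h1; rewrite subr0 in h1'.
exists (tilt eta Q L1').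
  apply: (tilt_gt0 Lg sg g0 gu sL1); rewrite -normr_gt0.
  by apply: lt_le_trans h1.
move=> L sL; have [->|L0'] := eqVneq L 0; first by rewrite normr0 mulr0 tilt_ge0.
have [s n] := nz _ sL L0'.
have := L1max _ s; rewrite subr0 n lexx => /(_ isT isT); rewrite lerN2 => h.
have nL : 0 < `|L| by rewrite normr_gt0.
have := ler_wpM2r (ltW nL) h.
by rewrite [leRHS]mulrC -tiltZ// scalerA mulfV ?gt_eqF// scale1r.
Qed.

(* Since exp x >= max(x, 0), the dual objective is at most - ln (tilt L), which
   tends to -oo because tilt is positively homogeneous and positive. *)
Lemma dual_argmax eta g : L1 g -> sint g = 1 -> aeS (fun p => 0 <= g p) ->
  let Q := moment g in aeS (fun p => qf Q p - eta <= 0 -> g p = 0) ->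
  exists L, is_argmax sym0 (dual_objective eta Q) L.
Proof.
move=> Lg sg g0 Q gu.
have Zpos L : 0 < Zpart eta Q L by exact: Zpart_gt0_of_density gu.
have [c c0 coer] := tilt_coercive Lg sg g0 gu.
have up L : sym0 L -> L != 0 -> dual_objective eta Q L <= - ln (c * `|L|).
  move=> sL L0; rewrite dual_objectiveE.
  have ch : c * `|L| <= expR (- frob Q L) * Zpart eta Q L.
    apply: le_trans (coer L sL) _; rewrite ZpartE -sintZ; last exact/bm_integrable/bm_Zpart.
    apply: le_sint; first exact/bm_integrable/bm_tilt.
      exact/L1Z/bm_integrable/bm_Zpart.
    move=> p _; rewrite mulrA ler_wpM2r ?weight_ge0// -expRD ge_max expR_ge0 andbT.
    by have := expR_ge1Dx (- frob Q L + qf L p); lra.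
  have cL : 0 < c * `|L| by rewrite mulr_gt0// normr_gt0.
  have : ln (c * `|L|) <= ln (expR (- frob Q L) * Zpart eta Q L).
    by rewrite ler_ln ?posrE// mulr_gt0 ?expR_gt0.
  rewrite lnM ?posrE ?expR_gt0// expRK.
  by move: (ln _) (ln _) (frob Q L) => x y z; lra.
(* With D the dual objective, c r = exp (- D(0)), so - ln (c |L|) is below D(0) outside the ball of
   radius r. *)
pose r := expR (- dual_objective eta Q 0) / c.
have r0 : 0 < r by rewrite divr_gt0 ?expR_gt0.
have [|L1' [sL1 _ _ L1max]] := sym0_EVT (A := 0) (a := 0) (b := r)
    (fun L L' => dual_objective_lipschitz L L' (Zpos 0)).
  by exists 0; rewrite subr0 normr0 lexx (ltW r0); split => //; exact: sym0_0.
have max0 := L1max 0 sym0_0; rewrite subr0 normr0 lexx (ltW r0) in max0.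
have {}max0 := max0 isT isT.
exists L1'; split; [exact: sL1|move=> L sL].
have [Lr|Lr] := leP `|L| r; first by apply: (L1max L sL); rewrite subr0.
apply: le_trans max0.
have L0 : L != 0 by rewrite -normr_gt0; exact: lt_trans Lr.
apply: le_trans (up L sL L0) _.
rewrite lerNl -[leLHS]expRK; have e0 := expR_gt0 (- dual_objective eta Q 0).
rewrite ler_ln ?posrE//; last by rewrite mulr_gt0// normr_gt0.
by rewrite mulrC -ler_pdivrMr// ltW.
Qed.

End argmax.

(** * Variation of Q *)

Section perturbation.
Context {R : realType}.
Implicit Types (f g h b : 'cV[R]_3 -> R) (p q : 'cV[R]_3) (A B L Q H : 'M[R]_3) (eta : R).

Lemma expR_diff_le (x y : R) : `|x - y| <= 1 / 2 ->
  `|expR x - expR y| <= 2 * `|x - y| * expR y.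
Proof.
move=> d; have e0 := expR_gt0 y.
have q := expR_le_quad d; have l := expR_ge1Dx (x - y).
have -> : expR x - expR y = (expR (x - y) - 1) * expR y.
  by rewrite mulrBl -expRD subrK mul1r.
rewrite normrM (gtr0_norm e0) ler_wpM2r ?(ltW e0)//.
have n := ler_norm (x - y); have n' := ler_norm (- (x - y)); rewrite normrN in n'.
have s : (x - y) ^+ 2 <= 1 / 2 * `|x - y|.
  by rewrite -real_normK ?num_real// expr2 ler_wpM2r.
by rewrite ler_norml; apply/andP; split; lra.
Qed.

Definition wsint L b : R := sint (fun p => expR (qf L p) * b p).

Lemma bm_wsint L b : bm b -> bm (fun p => expR (qf L p) * b p).
Proof. by move=> bb; apply: bmM; [apply: bm_expR; exact: bm_qf|exact: bb]. Qed.

Lemma normr_sint_le f g : L1 f -> L1 g -> (forall p, sphere2 p -> `|f p| <= g p) ->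
  `|sint f| <= sint g.
Proof.
move=> Lf Lg h; rewrite ler_norml -sintN//; apply/andP; split; apply: le_sint => //.
- by have := L1Z (-1) Lg; under eq_fun do rewrite mulN1r.
- by move=> p /h; rewrite ler_norml => /andP[].
- by move=> p /h; rewrite ler_norml => /andP[].
Qed.

(** The radius 1/18 keeps the change of the exponent below 1/2, as [expR_diff_le] requires. *)
Lemma wsint_continuous L b : bm b -> exists2 K, 0 <= K &
  forall L', `|L' - L| <= 1 / 18 -> `|wsint L' b - wsint L b| <= K * `|L' - L|.
Proof.
move=> bb; have [mb [C hC]] := bb.
have C0 : 0 <= `|C| := normr_ge0 C.
have be M : L1 (fun p => expR (qf M p)) by exact/bm_integrable/bm_expR/bm_qf.
exists (18 * `|C| * sint (fun p => expR (qf L p))).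
  by rewrite mulr_ge0 ?mulr_ge0// sint_ge0// => p _; exact: expR_ge0.
move=> L' dL; rewrite /wsint -sintB; last 2 first.
- exact/bm_integrable/bm_wsint.
- exact/bm_integrable/bm_wsint.
rewrite mulrAC -sintZ//; apply: normr_sint_le.
- by apply: L1B; exact/bm_integrable/bm_wsint.
- exact: L1Z.
move=> p Sp; rewrite -mulrBl normrM.
have q := normr_qf_le (L' - L) Sp; rewrite qfB in q.
have d12 : `|qf L' p - qf L p| <= 1 / 2 by lra.
have ed := expR_diff_le d12; have e0 := expR_ge0 (qf L p).
have bC : `|b p| <= `|C| by apply: le_trans (hC p Sp) (ler_norm _).
apply: (@le_trans _ _ ((2 * `|qf L' p - qf L p| * expR (qf L p)) * `|C|)).
  by apply: ler_pM.
rewrite -[leRHS]mulrAC [leRHS](_ : _ = (18 * `|L' - L| * expR (qf L p)) * `|C|); last by lra.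
by apply: ler_wpM2r => //; apply: ler_wpM2r => //; lra.
Qed.

Lemma Zpart_wsint eta Q L : Zpart eta Q L = wsint L (weight eta Q).
Proof. exact: ZpartE. Qed.

Lemma ln_dist_le (x y c : R) : 0 < x -> 0 <= c -> c <= 1 / 2 -> `|y - x| <= c * x ->
  0 < y /\ `|ln y - ln x| <= 2 * c.
Proof.
move=> x0 c0 c1; rewrite ler_norml => /andP[h1 h2].
have y0 : 0 < y.
  have : c * x <= 1 / 2 * x by rewrite ler_wpM2r// ltW.
  lra.
split => //.
have lnle (a b : R) : 0 < a -> 0 < b -> ln a - ln b <= a / b - 1.
  move=> a0 b0; rewrite -ln_div ?posrE//.
  have := @le_ln1Dx R (a / b - 1); rewrite (_ : 1 + (a / b - 1) = a / b); last lra.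
  apply.
  by have := divr_gt0 a0 b0; lra.
have l1 := lnle _ _ y0 x0; have l2 := lnle _ _ x0 y0.
have m1 : y / x - 1 <= c by rewrite lerBlDr ler_pdivrMr//; lra.
have m2 : x / y - 1 <= 2 * c.
  rewrite lerBlDr ler_pdivrMr//.
  have cx : c * x <= 2 * c * y.
    have -> : 2 * c * y = c * (2 * y) by lra.
    apply: ler_wpM2l => //.
    have : c * x <= 1 / 2 * x by rewrite ler_wpM2r// ltW.
    by lra.
  by lra.
by rewrite ler_norml; apply/andP; split; lra.
Qed.

Lemma sint_expR_gt0 eta Q L : 0 < Zpart eta Q L -> 0 < sint (fun p => expR (qf L p)).
Proof.
move=> Z0; have be M : bm (fun p => expR (qf M p)) by exact/bm_expR/bm_qf.
have [_ [C hC]] := bm_weight eta Q.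
have : Zpart eta Q L <= `|C| * sint (fun p => expR (qf L p)).
  rewrite ZpartE -sintZ; last exact: bm_integrable.
  apply: le_sint; [exact/bm_integrable/bm_Zpart|exact/L1Z/bm_integrable|].
  move=> p Sp; rewrite mulrC ler_wpM2r ?expR_ge0//.
  by apply: le_trans (ler_norm _) (le_trans (hC p Sp) (ler_norm _)).
have E0 : 0 <= sint (fun p => expR (qf L p)) by apply: sint_ge0 => p _; exact: expR_ge0.
rewrite lt_def E0 andbT => h; apply: contraTneq Z0 => E; move: h.
by rewrite E mulr0 leNgt => /negbTE ->.
Qed.

(* weight eta (Q + t H) is within |t| |H p . p| of weight eta Q. *)
Lemma Zpart_perturb eta Q L H : 0 < Zpart eta Q L -> exists2 D, 0 < D &
  forall r t L', 0 <= r -> 0 <= t -> `|L' - L| <= r ->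
  `|Zpart eta (Q + t *: H) L' - Zpart eta Q L'| <= D * expR (18 * r) * t * Zpart eta Q L'.
Proof.
move=> Z0; pose E M := sint (fun p => expR (qf M p)).
have E0 : 0 < E L := sint_expR_gt0 Z0.
have be M : bm (fun p => expR (qf M p)) by exact/bm_expR/bm_qf.
pose k := 9 * `|H| + 1; have k0 : 0 < k by rewrite /k; have := normr_ge0 H; lra.
(* The relative error is at most t k E(L') / Z(L'). Passing from L to L' costs a factor exp (9 r) in
   E and another in Z, hence exp (18 r). *)
exists (k * E L / Zpart eta Q L); first by rewrite divr_gt0 ?mulr_gt0.
move=> r t L' r0 t0 dL.
have EE : E L' <= expR (9 * r) * E L.
  rewrite /E -sintZ; last exact: bm_integrable.
  apply: le_sint; [exact: bm_integrable|exact/L1Z/bm_integrable|].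
  move=> p Sp; rewrite -expRD ler_expR.
  by have := normr_qf_le (L' - L) Sp; rewrite qfB ler_norml => /andP[_]; lra.
have ZZ : Zpart eta Q L <= expR (9 * r) * Zpart eta Q L'.
  apply: le_trans (Zpart_le_expR eta Q L' L) _; rewrite ler_wpM2r ?Zpart_ge0//.
  by rewrite ler_expR distrC; lra.
apply: (@le_trans _ _ (t * k * E L')).
  rewrite !ZpartE /E -sintZ; last exact: bm_integrable.
  rewrite -sintB; last 2 first.
  - exact/bm_integrable/bm_Zpart.
  - exact/bm_integrable/bm_Zpart.
  apply: normr_sint_le.
  - by apply: L1B; exact/bm_integrable/bm_Zpart.
  - exact/L1Z/bm_integrable.
  move=> p Sp; rewrite -mulrBr normrM ger0_norm ?expR_ge0// [leRHS]mulrC.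
  rewrite ler_wpM2l ?expR_ge0// /weight -/(qf _ p) -/(qf Q p) qfD qfZ.
  have := normr_qf_le H Sp => hH.
  have : `|t * qf H p| <= t * k.
    by rewrite normrM ger0_norm// ler_wpM2l// /k; lra.
  move: (t * qf H p) (t * k) => x y; rewrite !ler_norml => /andP[x1 x2].
  have [a|a] := leP (qf Q p + x - eta) 0; have [b|b] := leP (qf Q p - eta) 0;
    by apply/andP; split; lra.
have e9 : expR (18 * r) = expR (9 * r) * expR (9 * r) by rewrite -expRD; congr expR; lra.
rewrite e9; have p9 := expR_gt0 (9 * r).
set z := Zpart eta Q L in Z0 ZZ *; set z' := Zpart eta Q L' in ZZ *.
have -> : k * E L / z * (expR (9 * r) * expR (9 * r)) * t * z' =
  t * k * ((expR (9 * r) * E L) * ((expR (9 * r) * z') / z)) by lra.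
rewrite ler_wpM2l ?mulr_ge0 ?(ltW k0)//.
apply: le_trans EE _; rewrite ler_peMr ?mulr_ge0 ?(ltW p9) ?(ltW E0)//.
by rewrite ler_pdivlMr// mul1r.
Qed.

Lemma dual_perturb eta Q L H (r : R) : 0 < Zpart eta Q L -> 0 <= r ->
  exists2 C, 0 < C & forall t L', 0 <= t -> t * C <= 1 -> `|L' - L| <= r ->
    0 < Zpart eta (Q + t *: H) L' /\
    `|dual_objective eta (Q + t *: H) L' - dual_objective eta Q L'| <= C * t.
Proof.
move=> Z0 r0; have [D D0 hD] := Zpart_perturb H Z0.
pose c := D * expR (18 * r); have c0 : 0 < c by rewrite mulr_gt0 ?expR_gt0.
pose b := 9 * `|H| * (`|L| + r).
have b0 : 0 <= b by rewrite mulr_ge0 ?mulr_ge0 ?addr_ge0.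
(* 2 c bounds the change of ln Z through [ln_dist_le], and b that of the linear term. The condition
   t C <= 1 makes t c at most 1/2. *)
exists (2 * c + b); first by lra.
move=> t L' t0 tC dL.
have Z'0 : 0 < Zpart eta Q L' := Zpart_gt0 L' Z0.
have tb : 0 <= t * b by rewrite mulr_ge0.
have tc : 0 <= t * c by rewrite mulr_ge0// ltW.
have h := hD r t L' r0 t0 dL.
have tc2 : t * c <= 1 / 2 by move: tC; lra.
have [|Zt0 lnd] := @ln_dist_le _ (Zpart eta (Q + t *: H) L') (t * c) Z'0 tc tc2.
  by apply: le_trans h _; rewrite /c [t * _]mulrC.
split; first exact: Zt0.
rewrite !dual_objectiveE frobC frobDr frobZr (frobC L' Q) (frobC L' H).
have hH : `|frob H L'| <= b.
  apply: le_trans (normr_frob_le H L') _; rewrite ler_wpM2l ?mulr_ge0//.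
  by rewrite -(subrK L L') addrC; apply: le_trans (ler_normD _ _) _; rewrite lerD2l.
have tH : `|t * frob H L'| <= t * b by rewrite normrM ger0_norm// ler_wpM2l.
move: tH lnd; move: (t * frob H L') (frob Q L') (ln _) (ln _) => x y u v.
rewrite !ler_norml => /andP[x1 x2] /andP[u1 u2].
by apply/andP; split; lra.
Qed.

(* On a small sphere around the strict maximiser L the dual objective at Q stays
   below its value at L, and so does the one at Q + t H; the latter therefore has a
   critical point inside that sphere. *)
Lemma gibbs_perturb eta Q L H (r : R) : sym0 Q -> sym0 H -> 0 < r ->
  0 < Zpart eta Q L -> is_argmax sym0 (dual_objective eta Q) L ->
  (forall L', sym0 L' -> dual_objective eta Q L <= dual_objective eta Q L' -> L' = L) ->
  exists2 t0, 0 < t0 & forall t, 0 < t -> t < t0 ->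
    exists L', [/\ sym0 L', `|L' - L| <= r, 0 < Zpart eta (Q + t *: H) L' &
      moment (gibbs eta (Q + t *: H) L') = Q + t *: H].
Proof.
have no (x y z w s d : R) : 0 < d -> s <= d / 4 -> - s <= x - y -> z - w <= s ->
    w <= y - d -> x <= z -> False by lra.
move=> sQ sH r0 Z0 [sL maxL] uniq.
have pos0 M : 0 < Zpart eta Q M := Zpart_gt0 M Z0.
have [C C0 hC] := dual_perturb H Z0 (ltW r0).
have lip0 := fun L L' => dual_objective_lipschitz L L' (pos0 0).
have [d d0 hd] : exists2 d, 0 < d & forall L', sym0 L' -> `|L' - L| = r ->
    dual_objective eta Q L' <= dual_objective eta Q L - d.
  have [ex|none] := pselect (exists L', [/\ sym0 L', r <= `|L' - L| & `|L' - L| <= r]); last first.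
    exists 1 => // L' sL' dL; exfalso; apply: none; exists L'.
    by rewrite dL.
  have [M [sM rM Mr Mmax]] := sym0_EVT lip0 ex.
  exists (dual_objective eta Q L - dual_objective eta Q M).
    rewrite subr_gt0 ltNge; apply/negP => le.
    have ML := uniq M sM le; move: rM; rewrite ML subrr normr0.
    by rewrite leNgt r0.
  move=> L' sL' dL; rewrite opprB addrC subrK; apply: (Mmax L' sL'); by rewrite dL.
(* The perturbation moves the objective by at most d / 4 both at L and on the sphere of radius r, so
   the gap d between them survives. *)
pose t0 := Num.min (C^-1) (d / (4 * C)).
exists t0; first by rewrite lt_min invr_gt0 C0 divr_gt0// mulr_gt0.
move=> t tpos tt0.
have tC : t * C <= 1.
  rewrite -ler_pdivlMr// mul1r; apply: le_trans (ltW tt0) _.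
  by rewrite ge_min lexx.
have tCd : C * t <= d / 4.
  have : t <= d / (4 * C) by apply: le_trans (ltW tt0) _; rewrite ge_min lexx orbT.
  by rewrite ler_pdivlMr ?mulr_gt0//; lra.
have Lin : `|L - L| <= r by rewrite subrr normr0 ltW.
have [ZtL hL] := hC t L (ltW tpos) tC Lin.
have lipt := fun L1 L2 => dual_objective_lipschitz L1 L2 (Zpart_gt0 0 ZtL).
have [|L' [sL' _ L'r L'max]] := sym0_EVT (A := L) (a := 0) (b := r) lipt.
  by exists L; rewrite normr_ge0.
have [ZtL' hL'] := hC t L' (ltW tpos) tC L'r.
exists L'; split; [exact: sL'|exact: L'r|exact: ZtL'|].
have L'r' : `|L' - L| < r.
  rewrite lt_def L'r andbT; apply/eqP => /esym e.
  have h1 := hd L' sL' e.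
  have h2 := L'max L sL (normr_ge0 _) Lin.
  move: hL; rewrite ler_norml => /andP[a1 _].
  move: hL'; rewrite ler_norml => /andP[_ b2].
  exact: (no _ _ _ _ _ _ d0 tCd a1 b2 h1 h2).
apply: (@gibbs_stationary _ _ _ _ (r - `|L' - L|)).
- exact: sym0D (sym0Z t sH).
- exact: sL'.
- by rewrite subr_gt0.
- exact: ZtL'.
move=> M sM dM; apply: (L'max M sM); first exact: normr_ge0.
rewrite -(subrK L' M) -addrA; apply: le_trans (ler_normD _ _) _.
by rewrite -lerBrDr ltW.
Qed.

End perturbation.

Section variation.
Context {R : realType}.
Implicit Types (f g h b : 'cV[R]_3 -> R) (p q : 'cV[R]_3) (A B L Q H : 'M[R]_3) (eta : R).

(** A subgradient of Q -> [weight eta Q p] in the direction H; at the kink u = 0 it takes the value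
    0. *)
Definition slope eta Q H p : R := (0 < qf Q p - eta)%R%:R * qf H p.

Lemma bm_slope eta Q H : bm (slope eta Q H).
Proof.
apply: bmM; last exact: bm_qf.
by apply: bm_pos; apply: bmB; [exact: bm_qf|exact: bm_cst].
Qed.

Lemma Zpart_convex eta Q H L (t : R) :
  Zpart eta Q L + t * wsint L (slope eta Q H) <= Zpart eta (Q + t *: H) L.
Proof.
have LW := bm_integrable (bm_wsint L (bm_slope eta Q H)).
rewrite !ZpartE /wsint -sintZ// -sintD; last 2 first.
- exact/bm_integrable/bm_Zpart.
- exact: L1Z.
apply: le_sint.
- by apply: L1D; [exact/bm_integrable/bm_Zpart|exact: L1Z].
- exact/bm_integrable/bm_Zpart.
move=> p _; rewrite mulrCA -mulrDr ler_wpM2l ?expR_ge0//.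
rewrite /weight -/(qf (Q + t *: H) p) -/(qf Q p) qfD qfZ /slope.
have [u0|u0] := ltP 0 (qf Q p - eta); last first.
  by rewrite /= mul0r mulr0 addr0 le_max lexx orbT.
rewrite /= mul1r le_max; apply/orP; left; lra.
Qed.

(* Perturbing Q in the direction H lowers the energy to first order by the
   difference of the two sides. *)
Lemma gibbs_variation eta Q L H : sym0 Q -> sym0 H -> 0 < Zpart eta Q L ->
  is_argmax sym0 (dual_objective eta Q) L ->
  (forall L', sym0 L' -> dual_objective eta Q L <= dual_objective eta Q L' -> L' = L) ->
  (forall t L', sym0 L' -> 0 < Zpart eta (Q + t *: H) L' ->
    moment (gibbs eta (Q + t *: H) L') = Q + t *: H ->
    dual_objective eta Q L <= dual_objective eta (Q + t *: H) L') ->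
  wsint L (slope eta Q H) <= Zpart eta Q L * frob L H.
Proof.
have ln_gap (x y z w : R) : z - x <= z + w - y -> y <= x + w by lra.
move=> sQ sH Z0 amax uniq fmin; rewrite leNgt; apply/negP => lt.
have [K1 K10 hK1] := wsint_continuous L (bm_slope eta Q H).
have [K2 K20 hK2] := wsint_continuous L (bm_weight eta Q).
pose B := 9 * (`|L| + 1) * `|H|.
have B0 : 0 <= B by rewrite mulr_ge0 ?mulr_ge0 ?addr_ge0.
set V := wsint L _ in lt hK1; set Z := Zpart eta Q L in Z0 lt.
pose e := V - Z * frob L H; have e0 : 0 < e by rewrite subr_gt0.
(* Moving L by at most r changes the two sides by at most r s <= e / 2 in total, so half of the gap
   e survives. *)
pose s := K1 + K2 * B + Z * (9 * `|H|).
have s0 : 0 <= s by rewrite !addr_ge0 ?mulr_ge0 ?(ltW Z0).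
pose r := Num.min (1 / 18) (e / (2 * (s + 1))).
have s1 : 0 < 2 * (s + 1) by lra.
have r0 : 0 < r by rewrite lt_min !divr_gt0.
have r18 : r <= 1 / 18 by rewrite ge_min lexx.
have rs : r * s <= e / 2.
  have : r * (2 * (s + 1)) <= e by rewrite -ler_pdivlMr// ge_min lexx orbT.
  by have := r0; lra.
have hB L' : `|L' - L| <= r -> `|frob L' H| <= B.
  move=> dL; apply: le_trans (normr_frob_le _ _) _; rewrite ler_wpM2r// ler_wpM2l//.
  rewrite -(subrK L L') addrC; apply: le_trans (ler_normD _ _) _.
  by rewrite lerD2l; lra.
have gap L' : `|L' - L| <= r ->
    Zpart eta Q L' * frob L' H + e / 2 <= wsint L' (slope eta Q H).
  move=> dL; have d0 := normr_ge0 (L' - L).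
  have dL18 : `|L' - L| <= 1 / 18 by lra.
  have h1 := hK1 _ dL18; have h2 := hK2 _ dL18; rewrite -!Zpart_wsint -/Z in h2.
  have h3 := normr_frob_le (L' - L) H.
  rewrite frobC frobBr !(frobC H) in h3.
  have h4 := hB _ dL.
  have h5 : `|(Zpart eta Q L' - Z) * frob L' H| <= K2 * `|L' - L| * B.
    by rewrite normrM; apply: ler_pM.
  have h6 : Z * (frob L' H - frob L H) <= Z * (9 * `|L' - L| * `|H|).
    by rewrite ler_wpM2l ?(ltW Z0)//; apply: le_trans (ler_norm _) h3.
  have h7 : `|L' - L| * s <= e / 2.
    by apply: le_trans rs; rewrite ler_wpM2r.
  move: h1 h5; rewrite !ler_norml => /andP[h1 _] /andP[_ h5].
  move: (wsint L' _) (Zpart eta Q L') (frob L' H) h1 h5 h6 => v z a.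
  move: h7; rewrite /s /e; lra.
have [t0 t00 ht] := gibbs_perturb sQ sH r0 Z0 amax uniq.
pose c := B ^+ 2 * (Z + K2).
have c0 : 0 <= c by rewrite mulr_ge0 ?sqr_ge0// addr_ge0// ltW.
(* The bound by 1 / (2 (B + 1)) allows [expR_le_quad] for t a; the one by e / (4 (c + 1)) makes the
   quadratic remainder smaller than e / 2. Halving makes all the bounds strict. *)
pose t := Num.min t0 (Num.min (1 / (2 * (B + 1))) (e / (4 * (c + 1)))) / 2.
have B1 : 0 < 2 * (B + 1) by lra.
have c1 : 0 < 4 * (c + 1) by lra.
have tm : 0 < Num.min t0 (Num.min (1 / (2 * (B + 1))) (e / (4 * (c + 1)))).
  by rewrite !lt_min t00 !divr_gt0.
have tpos : 0 < t by rewrite divr_gt0.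
have tlt : t < Num.min t0 (Num.min (1 / (2 * (B + 1))) (e / (4 * (c + 1)))).
  by rewrite /t; lra.
move: tlt; rewrite !lt_min => /and3P[tt0 tB tc].
rewrite ltr_pdivlMr// in tB; rewrite ltr_pdivlMr// in tc.
have [L' [sL' dL Zt0 mom]] := ht t tpos tt0.
have Z'0 : 0 < Zpart eta Q L' := Zpart_gt0 L' Z0.
have cvx := Zpart_convex eta Q H L' t.
have gapL := gap L' dL; have aB := hB L' dL.
have le1 := fmin t L' sL' Zt0 mom; have le2 := amax.2 L' sL'.
(* The chain runs from the dual objective at (Q, L') through (Q, L), by maximality of L, to (Q + t
   H, L'), by minimality of f. It bounds Z(Q + t H, L') by Z(Q, L') exp (t a). *)
have := le_trans le2 le1; rewrite !dual_objectiveE frobC.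
rewrite [frob (Q + _) _]frobC frobDr frobZr => lnle.
set a := frob L' H in gapL aB lnle.
have Zt_le : Zpart eta (Q + t *: H) L' <= Zpart eta Q L' * expR (t * a).
  rewrite -ler_ln ?posrE// ?mulr_gt0 ?expR_gt0//.
  rewrite lnM ?posrE ?expR_gt0// expRK.
  exact: (ln_gap _ _ _ _ lnle).
clear le1 le2 lnle.
have ta : `|t * a| <= t * B by rewrite normrM gtr0_norm// ler_wpM2l// ltW.
have ta2 : `|t * a| <= 1 / 2 by lra.
have q := expR_le_quad ta2.
have a2 : a ^+ 2 <= B ^+ 2 by rewrite -real_normK ?num_real// ler_sqr ?nnegrE.
have Z'le : Zpart eta Q L' <= Z + K2.
  have dL18 : `|L' - L| <= 1 / 18 by lra.
  have := hK2 _ dL18; rewrite -!Zpart_wsint -/Z ler_norml => /andP[_ h].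
  have : K2 * `|L' - L| <= K2 * 1 by rewrite ler_wpM2l//; lra.
  by lra.
move: (Zpart eta Q L') (wsint L' _) (Zpart eta (Q + t *: H) L')
  Z'0 cvx gapL Zt_le Z'le => z v zt z0 cvx gapL zle z'le.
have zq : zt <= z * (1 + t * a + 2 * (t * a) ^+ 2).
  by apply: le_trans zle _; rewrite ler_wpM2l// ltW.
have key : t * (e / 2) <= t * (2 * t * (z * a ^+ 2)).
  have g1 : t * (z * a + e / 2) <= t * v by rewrite ler_wpM2l// ltW.
  have -> : t * (2 * t * (z * a ^+ 2)) = z * (2 * (t * a) ^+ 2) by lra.
  by move: zq cvx g1; lra.
rewrite ler_pM2l// in key.
have za : z * a ^+ 2 <= c.
  by rewrite /c mulrC; apply: ler_pM => //; [exact: sqr_ge0|exact: ltW].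
have tza : t * (z * a ^+ 2) <= t * c by rewrite ler_wpM2l// ltW.
by move: key tc tza; lra.
Qed.

End variation.

(** * Finite energies and physical moments *)

Section test_density.
Context {R : realType}.
Implicit Types (f g h b : 'cV[R]_3 -> R) (p q : 'cV[R]_3) (A B L Q H : 'M[R]_3) (eta : R).

Lemma sint_null f : hausdorff2 (@sphere2 R) = 0%E -> L1 f -> sint f = 0.
Proof.
move=> S0 Lf; apply: sint_ae0 => //; exists (@sphere2 R); split.
- exact: measurable_sphere.
- exact: S0.
- by move=> p /not_implyP[].
Qed.

Lemma aeS_measure0 (P : 'cV[R]_3 -> Prop) : aeS P ->
  hausdorff2 [set p | sphere2 p /\ ~ P p] = 0%E.
Proof.
move=> [N [mN N0 sub]]; apply/eqP; rewrite eq_le hausdorff2_ge0 andbT.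
have <- : hausdorff2 N = 0%E by exact: N0.
by apply: le_hausdorff2 => p [Sp nP]; apply: sub => /(_ Sp).
Qed.

(** On the sphere 2 - 2 p . p' = |p - p'|^2 <= 2 |p - q|^2 + 2 |p' - q|^2 <= 8 s. *)
Lemma cap_dot_ge (q p p' : 'cV[R]_3) (s : R) : sphere2 q -> sphere2 p -> sphere2 p' ->
  1 - s <= dot p q -> 1 - s <= dot p' q -> 1 - 4 * s <= dot p p'.
Proof.
move=> /sphere2P qq /sphere2P pp /sphere2P pp' h h'.
have sq i : (p i 0 - p' i 0) ^+ 2 <= 2 * (p i 0 - q i 0) ^+ 2 + 2 * (p' i 0 - q i 0) ^+ 2.
  by have := sqr_ge0 (p i 0 + p' i 0 - 2 * q i 0); lra.
have := sq i0; have := sq i1; have := sq i2.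
by move: qq pp pp' h h'; rewrite !dotE; lra.
Qed.

(* The uniform density on a small cap around q has its moment close to that of a
   Dirac mass at q, for which (Q p, p) = 2/3 at p = q. *)
Lemma finite_energy_exists eta : eta < 2 / 3 -> (0 < hausdorff2 (@sphere2 R))%E ->
  exists2 g : 'cV[R]_3 -> R, density g & (energy eta g < +oo)%E.
Proof.
move=> eta23 S0.
(* On the cap p . p' >= 1 - 4 s, so u >= (1 - 4 s)^2 - 1/3 - eta >= [u0]. The second bound on s
   leaves [u0] at least (2/3 - eta) / 2; the first keeps 1 - 4 s positive. *)
pose s := Num.min (1 / 8) ((2 / 3 - eta) / 16).
have d0 : 0 < (2 / 3 - eta) / 16 by lra.
have s0 : 0 < s by rewrite lt_min d0 andbT; lra.
have s8 : s <= 1 / 8 by rewrite ge_min lexx.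
have se : s <= (2 / 3 - eta) / 16 by rewrite ge_min lexx orbT.
pose u0 := 2 / 3 - 8 * s - eta; have u00 : 0 < u0 by rewrite /u0; lra.
(* The smaller cap lies where the strict inequality defining [ind] holds. *)
have s20 : 0 < s / 2 by rewrite divr_gt0.
have [q Sq capq] := cap_gt0 S0 s20.
pose ind p : R := (0 < dot p q - (1 - s))%R%:R.
have bind : bm ind.
  apply: bm_pos; apply: bmB; last exact: bm_cst.
  split; first exact/measurable_funTS/measurable_dot.
  have bq : bm (fun p => p i0 0 * q i0 0 + p i1 0 * q i1 0 + p i2 0 * q i2 0).
    have b i : bm (fun p : 'cV[R]_3 => p i 0 * q i 0).
      by apply: bmM; [exact: bm_coord|exact: bm_cst].
    by apply: bmD; [apply: bmD; exact: b|exact: b].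
  by have [_ [C hC]] := bq; exists C => p Sp; rewrite dotE; exact: hC.
have ind01 p : 0 <= ind p by rewrite /ind; case: (0 < _).
pose c := sint ind.
have c0 : 0 < c.
  rewrite lt_def sint_ge0// andbT; apply/eqP => c0.
  have := sint_le0_ae (bm_integrable bind) (aeS_all (fun p _ => ind01 p)).
  rewrite -/c c0 lexx => /(_ isT) /aeS_measure0 h0.
  move: capq; rewrite ltNge => /negP; apply; rewrite -h0.
  apply: le_hausdorff2 => p [Sp h]; split => //=.
  by rewrite /ind (_ : 0 < _ = true)//; [move=> /eqP; rewrite oner_eq0|apply/idP; lra].
pose g p := c^-1 * ind p.
have bg : bm g by apply: bmM; [exact: bm_cst|exact: bind].
have Lg : L1 g := bm_integrable bg.
have g0 p : 0 <= g p by rewrite mulr_ge0// invr_ge0 ltW.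
have sg : sint g = 1.
  by rewrite sintZ ?mulVf ?gt_eqF//; exact: bm_integrable.
have dg : density g.
  by split; [exact: Lg|apply: aeS_all => p _; exact: g0|rewrite -sintE].
exists g => //; rewrite energyE//; set Q := moment g.
have capP p : ind p != 0 -> 1 - s <= dot p q.
  by rewrite /ind; case: ltP => [h _|_]; [lra|rewrite eqxx].
have ulow p : sphere2 p -> ind p != 0 -> u0 <= qf Q p - eta.
  move=> Sp ip; rewrite lerBrDr.
  rewrite -inner_moment//.
  have -> : u0 + eta = sint (fun p => (2 / 3 - 8 * s) * g p).
    by rewrite sintZ// sg /u0; lra.
  apply: le_sint; first exact: L1Z.
    under eq_fun do rewrite mulrC.
    apply: (L1M Lg); apply: bmB; last exact: bm_cst.
    have bq : bm (fun x => dot p x).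
      under eq_fun do rewrite dotE.
      have b i : bm (fun x : 'cV[R]_3 => p i 0 * x i 0).
        by apply: bmM; [exact: bm_cst|exact: bm_coord].
      by apply: bmD; [apply: bmD; exact: b|exact: b].
    under eq_fun do rewrite expr2.
    exact: bmM.
  move=> p' Sp'; rewrite /g; have [->|ip'] := eqVneq (ind p') 0; first by rewrite !mulr0.
  rewrite ler_wpM2r ?g0//.
  have := cap_dot_ge Sq Sp Sp' (capP _ ip) (capP _ ip').
  move: (dot p p') => x hx.
  have hx2 : (1 - 4 * s) * (1 - 4 * s) <= x * x by apply: ler_pM => //; lra.
  have := mulr_ge0 (ltW s0) (ltW s0).
  by rewrite expr2; lra.
pose K := 9 * `|Q| + `|eta|.
have uK p : sphere2 p -> qf Q p - eta <= K.
  move=> Sp; have := normr_qf_le Q Sp; rewrite /K ler_norml => /andP[_ h].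
  by have := ler_norm (- eta); rewrite normrN; lra.
pose e p := g p * (ln (g p) - ln (qf Q p - eta)).
have be : bm e.
  split.
    apply: measurable_funM; first exact: bg.1.
    apply: measurable_funB; apply: measurableT_comp.
    - exact: measurable_ln.
    - exact: bg.1.
    - exact: measurable_ln.
    - exact: (bmB (bm_qf Q) (bm_cst eta)).1.
  exists (c^-1 * (`|ln c^-1| + (`|ln u0| + `|ln K|))) => p Sp.
  have ci : 0 < c^-1 by rewrite invr_gt0.
  have bnd0 : 0 <= c^-1 * (`|ln c^-1| + (`|ln u0| + `|ln K|)).
    by rewrite mulr_ge0 ?addr_ge0// ltW.
  have [i0'|ip] := eqVneq (ind p) 0; first by rewrite /e /g i0' mulr0 mul0r normr0.
  have -> : e p = c^-1 * (ln c^-1 - ln (qf Q p - eta)).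
    rewrite /e /g; have -> : ind p = 1; last by rewrite mulr1.
    by move: ip; rewrite /ind; case: (0 < _) => //; rewrite eqxx.
  have u1 := ulow p Sp ip; have u2 := uK p Sp.
  have upos : 0 < qf Q p - eta := lt_le_trans u00 u1.
  rewrite normrM (gtr0_norm ci) ler_wpM2l ?(ltW ci)//.
  apply: le_trans (ler_normB _ _) _; rewrite lerD2l.
  have l1 : ln u0 <= ln (qf Q p - eta) by rewrite ler_ln ?posrE.
  have l2 : ln (qf Q p - eta) <= ln K by rewrite ler_ln ?posrE// (lt_le_trans upos).
  move: (ln _) (ln _) (ln _) l1 l2 => x y z l1 l2.
  have := ler_norm x; have := ler_norm (- z); rewrite normrN.
  have := normr_ge0 x; have := normr_ge0 z.
  by move=> *; rewrite ler_norml; apply/andP; split; lra.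
have -> : (\int[dS R]_(p in @sphere2 R) ((g p * ln (g p))%:E -
    (g p)%:E * lne (qf Q p - eta)%:E) = (sint e)%:E)%E.
  rewrite -integral_sint; last exact: bm_integrable.
  apply: eq_integral => p /set_mem Sp.
  have [i0'|ip] := eqVneq (ind p) 0.
    by rewrite /e /g i0' mulr0 !mul0r mul0e sube0.
  rewrite lne_EFin; last exact: lt_le_trans u00 (ulow p Sp ip).
  by rewrite -EFinM -EFinB /e mulrBr.
exact: ltry.
Qed.

(** The area of the sphere is not computed: it is positive because the sphere carries a function of
    integral one. *)
Lemma density_sphere_gt0 f : density f -> (0 < hausdorff2 (@sphere2 R))%E.
Proof.
move=> [Lf _ sf]; rewrite lt_def hausdorff2_ge0 andbT; apply/eqP => S0.
by have := oner_neq0 R; rewrite -sf -sintE sint_null// eqxx.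
Qed.

End test_density.

Section physical.
Context {R : realType}.
Implicit Types (f g h b : 'cV[R]_3 -> R) (p q : 'cV[R]_3) (A B L Q H : 'M[R]_3) (eta : R).

Lemma bm_sum (F : 'I_3 -> 'cV[R]_3 -> R) :
  (forall i, bm (F i)) -> bm (fun p => \sum_i F i p).
Proof.
by move=> bF; under eq_fun do rewrite sum_I3; apply: bmD; [apply: bmD|]; exact: bF.
Qed.

(** [vmin] is an infimum, so the strict bound on each eigenvalue has to be made uniform: the
    characteristic polynomial has no roots just to the right of -1/3. *)
Lemma poly_right_neq0 (P : {poly R}) (c : R) : P != 0 ->
  exists2 d, 0 < d & forall x, c < x -> x < c + d -> P.[x] != 0.
Proof.
have [n] := ubnP (size P); elim: n P => // n ih P; rewrite ltnS => szP P0.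
have [h|/existsNP[y /not_implyP[cy /negP]]] := pselect (forall x, c < x -> P.[x] != 0).
  by exists 1 => // x cx _; exact: h.
rewrite negbK => /factor_theorem [Q PQ].
have Q0 : Q != 0 by apply: contra_neq P0 => Q0; rewrite PQ Q0 mul0r.
have szQ : (size Q < n)%N.
  by apply: leq_trans szP; rewrite PQ size_Mmonic ?monicXsubC// size_XsubC addn2.
have [d d0 hd] := ih _ szQ Q0; exists (Num.min d (y - c)).
  by rewrite lt_min d0 subr_gt0.
move=> x cx; rewrite -ltrBlDl lt_min => /andP[xd xy].
rewrite PQ hornerM hornerXsubC mulf_neq0//; first by apply: hd => //; rewrite -ltrBlDl.
by rewrite subr_eq0 lt_eqF//; lra.
Qed.

(** For an eigenvector w, the integral of f (p . w)^2 is (a + 1/3)|w|^2. Were it nonpositive, f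
    would be concentrated on the plane orthogonal to w, which is a quadric. *)
Lemma moment_eigenvalue_gt f (a : R) : density f -> eigenvalue (moment f) a ->
  - (1 / 3) < a.
Proof.
move=> df; have [Lf f0 sf] := df; move=> /eigenvalueP[v vE v0].
have [Qs _] := sym0_moment Lf; set Q := moment f in vE Qs *.
pose w : 'cV[R]_3 := v^T; pose B : 'M[R]_3 := w *m w^T.
have QE : qf Q w = a * dot w w.
  by rewrite /qf /dot trmx_mul Qs /w trmxK vE -scalemxAl mxE.
have BE p : qf B p = dot p w ^+ 2.
  have Bij i j : B i j = w i 0 * w j 0 by rewrite /B mxE big_ord1 [X in _ * X]mxE.
  by rewrite qfE !sum_I3 !Bij dotE; lra.
have Bs : B^T = B by rewrite /B trmx_mul trmxK.
have LB : L1 (fun p => f p * qf B p) by exact/(L1M Lf)/bm_qf.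
have sB : sint (fun p => f p * qf B p) = (a + 1 / 3) * dot w w.
  have -> : (a + 1 / 3) * dot w w = qf Q w + sint (fun p => (1 / 3 * dot w w) * f p).
    rewrite sintZ// (_ : sint f = 1); last by rewrite sintE.
    by rewrite QE; lra.
  rewrite qfE sum_moment// -sintD; last 2 first.
  - apply: (L1M Lf); apply: bm_sum => i; apply: bm_sum => j.
    by apply: bmM; [exact: bm_tless|exact: bm_cst].
  - exact: L1Z.
  apply: eq_sint => p /sphere2P pp; rewrite BE !dotE !sum_I3 !tlessE/=; lra.
have fB0 : aeS (fun p => 0 <= f p * qf B p).
  by apply: (aeS_imp f0) => p _ fp; rewrite BE mulr_ge0 ?sqr_ge0.
have w0 : 0 < dot w w.
  rewrite lt_def dotE -!expr2 !addr_ge0 ?sqr_ge0 ?andbT//.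
  apply: contra v0 => /eqP ww; apply/eqP/matrixP => i j; rewrite ord1 mxE.
  have z0 := sqr_ge0 (w i0 0); have z1 := sqr_ge0 (w i1 0); have z2 := sqr_ge0 (w i2 0).
  have wE k : v 0 k = w k 0 by rewrite mxE.
  by rewrite wE; apply/eqP; rewrite -sqrf_eq0; apply/eqP; elim/I3_ind: j; lra.
rewrite ltNge; apply/negP => a3.
have sle : sint (fun p => f p * qf B p) <= 0.
  by rewrite sB pmulr_lle0//; lra.
have /(congr1 (fun M : 'M[R]_3 => \tr M)) := density_quadric Lf (etrans (sintE f) sf) Bs
  (sint_le0_ae LB fB0 sle).
rewrite mxtrace0 /B mxtrace_mulC /mxtrace big_ord1 -/(dot w w) => w00.
by rewrite w00 ltxx in w0.
Qed.

Lemma physQ_moment f : density f -> physQ (moment f).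
Proof.
move=> df; have [Lf _ _] := df; split; first exact: sym0_moment.
have [d d0 hd] := poly_right_neq0 (- (1 / 3)) (monic_neq0 (char_poly_monic (moment f))).
have [[a ea]|none] := pselect ([set a | eigenvalue (moment f) a] !=set0); last first.
  (* The infimum of the empty set is 0 by convention. *)
  rewrite /vmin (_ : [set a | _] = set0) ?inf0; first by lra.
  by apply/seteqP; split => // x ex; apply: none; exists x.
apply: (@lt_le_trans _ _ (- (1 / 3) + d)); first by rewrite ltrDl.
apply: lb_le_inf; first by exists a.
move=> x /= ex; rewrite leNgt; apply/negP => xd.
have := hd x (moment_eigenvalue_gt df ex) xd.
by move: ex; rewrite eigenvalue_root_char => /rootP ->; rewrite eqxx.
Qed.

Lemma energy_ae_eq eta f g : density f -> density g ->
  (energy eta f < +oo)%E -> (energy eta g < +oo)%E ->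
  aeS (fun p => f p = g p) -> energy eta f = energy eta g.
Proof.
move=> df dg foo goo fg; have [Lf _ _] := df; have [Lg _ _] := dg.
have mfg : moment f = moment g.
  apply/matrixP => i j; rewrite !momentE; apply: ae_eq_sint.
  - by apply: (L1M Lf); exact: bm_tless.
  - by apply: (L1M Lg); exact: bm_tless.
  - by apply: (aeS_imp fg) => p _ ->.
have [_ Lef ->] := finite_energy df foo; have [_ Leg ->] := finite_energy dg goo.
have efg : aeS (fun p => f p * ln (f p) - f p * ln (qf (moment f) p - eta) =
    g p * ln (g p) - g p * ln (qf (moment g) p - eta)).
  by apply: (aeS_imp fg) => p _ ->; rewrite mfg.
exact: (congr1 EFin (ae_eq_sint Lef Leg efg)).
Qed.

End physical.

(** * The minimiser and its Euler-Lagrange equation *)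

Section minimiser.
Context {R : realType}.
Implicit Types (f g h b : 'cV[R]_3 -> R) (p q : 'cV[R]_3) (A B L Q H : 'M[R]_3) (eta : R).

Lemma argmax_gibbs eta Q L : sym0 Q -> 0 < Zpart eta Q L ->
  is_argmax sym0 (dual_objective eta Q) L ->
  moment (gibbs eta Q L) = Q /\
  energy eta (gibbs eta Q L) = (dual_objective eta Q L)%:E.
Proof.
move=> sQ Z0 [sL maxL].
have mQ : moment (gibbs eta Q L) = Q.
  by apply: (gibbs_stationary sQ sL (@ltr01 R) Z0) => L' sL' _; exact: maxL.
by split; [exact: mQ|exact: energy_gibbs].
Qed.

Lemma finite_energy_argmax eta g : density g -> (energy eta g < +oo)%E ->
  (forall L, 0 < Zpart eta (moment g) L) /\
  exists L, is_argmax sym0 (dual_objective eta (moment g)) L.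
Proof.
move=> dg goo; have [Lg g0 sg] := dg; rewrite -sintE in sg.
have [gu _ _] := finite_energy dg goo.
split; last exact: (dual_argmax Lg sg g0 gu).
by move=> L; exact: (Zpart_gt0_of_density L Lg sg gu).
Qed.

(** For a Gibbs density, f / u is exp (L p . p) / Z where u > 0. This is bounded, so the quotient is
    integrable although u may be arbitrarily small, and its pairing with H is the integrated [slope]
    divided by Z. *)
Lemma moment_quotient eta f L : let Q := moment f in
  0 < Zpart eta Q L -> sym0 L -> aeS (fun p => f p = gibbs eta Q L p) ->
  (forall H, sym0 H -> Zpart eta Q L * frob L H = wsint L (slope eta Q H)) ->
  L = moment (quotient eta f Q).
Proof.
move=> Q Z0 sL fE slopeE.
pose h p := (Zpart eta Q L)^-1 * (expR (qf L p) * (0 < qf Q p - eta)%R%:R).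
have bh : bm h.
  apply: bmM; first exact: bm_cst.
  apply: bm_wsint; apply: bm_pos.
  by apply: bmB; [exact: bm_qf|exact: bm_cst].
have hq : aeS (fun p => h p = quotient eta f Q p).
  apply: (aeS_imp fE) => p _ fp; rewrite /quotient -/(qf Q p) -subr_gt0 /h.
  case: ifPn => [u0|u0]; last by rewrite !mulr0.
  have wE : weight eta Q p = qf Q p - eta by rewrite /weight max_l// ltW.
  by rewrite fp gibbsE wE !mulrA mulfK ?gt_eqF// mulr1.
have Lh := bm_integrable bh; have Lq := ae_eq_L1 Lh hq.
apply: sym0_frob_inj; [exact: sL|exact: sym0_moment|].
move=> H sH; rewrite (frob_moment Lq sH.2).
rewrite -(@ae_eq_sint _ (fun p => h p * qf H p)); first last.
- by apply: (aeS_imp hq) => p _ ->.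
- by apply: (L1M Lq); exact: bm_qf.
- by apply: (L1M Lh); exact: bm_qf.
have -> : sint (fun p => h p * qf H p) = (Zpart eta Q L)^-1 * wsint L (slope eta Q H).
  rewrite /wsint -sintZ; last exact/bm_integrable/bm_wsint/bm_slope.
  by apply: eq_sint => p _; rewrite /h /slope -!mulrA.
by rewrite -slopeE// mulrA mulVf ?gt_eqF// mul1r.
Qed.

End minimiser.

Theorem theorem3p19 (R : realType) (eta : R) (f : 'cV[R]_3 -> R)
    (eta_lt : eta < 2 / 3)
    (f_density : density f)
    (f_min : forall g : 'cV[R]_3 -> R, density g ->
      (energy eta f <= energy eta g)%E) :
  exists (Q L : 'M[R]_3) (Z : R),
    [/\ sym0 Q, sym0 L & 0 < Z] /\
    [/\ {ae dS R, forall p, sphere2 p ->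
          f p = Z^-1 * expR (dot (L *m p) p) * Num.max (dot (Q *m p) p - eta) 0},
        Q = moment f
      & L = moment (quotient eta f Q)] /\
    saddle_solution eta Q L /\
    (physQ Q /\ forall Q0 : 'M[R]_3, physQ Q0 -> (J eta Q <= J eta Q0)%E).
Proof.
have fin_le (a b : \bar R) (x y : R) :
    a = x%:E -> b = y%:E -> (a <= b)%E -> x <= y.
  by move=> -> ->; rewrite lee_fin.
have [g dg goo] := finite_energy_exists eta_lt (density_sphere_gt0 f_density).
have foo : (energy eta f < +oo)%E := le_lt_trans (f_min g dg) goo.
have [Lf _ _] := f_density.
have [Zpos [L Lmax]] := finite_energy_argmax f_density foo.
set Q := moment f in Zpos Lmax.
have sQ : sym0 Q := sym0_moment Lf.
have sL : sym0 L := Lmax.1.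
have [mQ eG] := argmax_gibbs sQ (Zpos L) Lmax.
have f_gibbs L' : is_argmax sym0 (dual_objective eta Q) L' ->
    aeS (fun p => f p = gibbs eta Q L' p).
  move=> L'max; have [_ eG'] := argmax_gibbs sQ (Zpos L') L'max.
  apply: (energy_le_dual_gibbs f_density L'max.1 (Zpos L') foo).
  by rewrite -eG'; apply: f_min; exact: density_gibbs.
have fE := f_gibbs L Lmax.
have ef : energy eta f = (dual_objective eta Q L)%:E.
  rewrite -eG; apply: energy_ae_eq fE; [exact: f_density| |exact: foo|].
    exact: density_gibbs.
  by rewrite eG ltry.
(* Every maximiser has f as its Gibbs density, and the Gibbs density determines the matrix. *)
have uniq L' : sym0 L' -> dual_objective eta Q L <= dual_objective eta Q L' -> L' = L.
  move=> sL' le; have L'max : is_argmax sym0 (dual_objective eta Q) L'.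
    by split; [exact: sL'|move=> M sM; exact: le_trans (Lmax.2 M sM) le].
  apply: (gibbs_inj sL' sL (Zpos L') (Zpos L)).
  by apply: (aeS_imp2 (f_gibbs L' L'max) fE) => p _ -> .
have dual_min H t L' : sym0 H -> sym0 L' -> 0 < Zpart eta (Q + t *: H) L' ->
    moment (gibbs eta (Q + t *: H) L') = Q + t *: H ->
    dual_objective eta Q L <= dual_objective eta (Q + t *: H) L'.
  move=> sH sL' Zt mt.
  exact: (fin_le _ _ _ _ ef (energy_gibbs sL' Zt mt) (f_min _ (density_gibbs Zt))).
have slope_le H : sym0 H -> wsint L (slope eta Q H) <= Zpart eta Q L * frob L H.
  move=> sH; apply: (gibbs_variation sQ sH (Zpos L) Lmax uniq) => t L'.
  exact: dual_min.
(* Both sides are linear in H, so the inequality for -H is the reverse one. *)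
have slopeE H : sym0 H -> Zpart eta Q L * frob L H = wsint L (slope eta Q H).
  move=> sH; apply/eqP; rewrite eq_le slope_le// andbT.
  have := slope_le _ (sym0Z (-1) sH).
  have -> : wsint L (slope eta Q (-1 *: H)) = - wsint L (slope eta Q H).
    rewrite /wsint -sintN; last exact/bm_integrable/bm_wsint/bm_slope.
    by apply: eq_sint => p _; rewrite /slope qfZ; lra.
  by rewrite frobZr mulN1r mulrN lerN2.
have JQ : (J eta Q <= energy eta f)%E by apply: ereal_inf_lbound; exists f.
have pQ : physQ Q := physQ_moment f_density.
exists Q, L, (Zpart eta Q L); split; first by split; [|exact: sL|exact: Zpos].
split; first split.
- exact: fE.
- by [].
- exact: moment_quotient.
split; last split; first split.
- by split; [exact: pQ|exact: le_lt_trans JQ foo].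
- exact: Lmax.
(* The Gibbs density of the maximiser at Q0 competes with f, and both energies equal their dual
   objectives. *)
- move=> Q0 [[sQ0 _]] /ereal_inf_lt[_ [g0 [dg0 mg0] <-] g0oo].
  have [Zpos0 [L0 L0max]] := finite_energy_argmax dg0 g0oo.
  rewrite mg0 in Zpos0 L0max; exists L0; first exact: L0max.
  have [_ eG0] := argmax_gibbs sQ0 (Zpos0 L0) L0max.
  exact: (fin_le _ _ _ _ ef eG0 (f_min _ (density_gibbs (Zpos0 L0)))).
- exact: pQ.
- move=> Q0 _; apply: le_trans JQ _.
  by apply: le_ereal_inf_tmp => _ [g0 [dg0 _] <-]; exact: f_min.
Qed.
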